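(* If $D^\varepsilon$ is infinite, then the flag complex $Fl(\Gamma)$ of the opposition graph $\Gamma$ of a $-\varepsilon$-hermitian hyperbolic module $M$ is acyclic and its geometric realization is contractible. Consequently, there is in equivariant homology a natural isomorphism $$H^{\mathbf U(M)}_*(Fl(\Gamma))\xrightarrow{\ \cong\ } H_*(\mathbf U(M))$$ induced by the constant map $Fl(\Gamma)\to Fl(\{pt\})$, and similarly for cohomology.
   Context: $D$ is a field or division ring of arbitrary characteristic with an involution $J$ (an antiautomorphism with $J^2=\mathrm{id}$; $J=\mathrm{id}$ is allowed if $D$ is commutative), $\varepsilon\in\{1,-1\}$, and $D^\varepsilon=\{a\in D\mid a-a^J\varepsilon=0\}$. Modules are finite dimensional right $D$-modules. For $\delta=\pm1$, a $\delta$-hermitian form on $M$ is a biadditive map $h:M\times M\to D$ with $h(ua,vb)=a^Jh(u,v)b$ and $h(u,v)=h(v,u)^J\delta$. For a right $D$-module $X$, $X^J$ is its dual space made into a right $D$-module by $(\xi a)(v)=a^J\xi(v)$. The hyperbolic $\delta$-hermitian module on $X$ is $X\oplus X^J$ with the form $h_X((x,\xi),(y,\eta))=\xi(y)+\eta(x)^J\delta$; every isometric module is also called hyperbolic. $\mathbf U(M)$ is the group of isometries of $M$. A Lagrangian is a subspace $X\subseteq M$ with $X=X^\perp$. Two Lagrangians $X,Y$ are opposite if $X\cap Y=0$ (equivalently $M=X+Y$). Opposition graph: $\Gamma$ has the Lagrangians of $M$ as vertices, and its edges are the unordered pairs of opposite Lagrangians. Flag complex: for a graph $\Gamma=(V,E)$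 (undirected, no loops or multiple edges), $Fl(\Gamma)$ is the simplicial set whose $k$-simplices are the tuples $(x_0,\dots,x_k)$ of vertices such that for all $\mu<\nu$ either $x_\mu=x_\nu$ or $\{x_\mu,x_\nu\}\in E$; its chain complex $C_*(Fl(\Gamma))$ is the free $\mathbb Z$-module on these simplices with the usual boundary. Acyclic means having the homology of a point. Equivariant (co)homology: for a group $G$ acting on a chain complex $C_*$ and a projective resolution $P_*\to\mathbb Z$ of $G$ over $\mathbb Z$, $H_*^G(C_* )$ is the total homology of the double complex $P_*\otimes_GC_*$, and $H^*_G(C_*;A)$ is the cohomology of $\mathrm{Hom}_{\mathbb Z}(P_*\otimes_GC_*,A)$ for a coefficient group $A$ with trivial action. $H_*^{\mathbf U(M)}(Fl(\Gamma))$ means $H_*^{\mathbf U(M)}(C_*(Fl(\Gamma)))$ for the natural action of $\mathbf U(M)$; for a one-point complex this is the group homology $H_*(\mathbf U(M))$ of the abstract group. *)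

(* Defs.v *)
From HB Require Import structures.
From mathcomp Require Import all_boot all_order all_algebra.
From mathcomp Require Import all_classical reals topology normedtype.
From mathcomp Require Import generic_quotient ring_quotient freeg.
Set Implicit Arguments.
Unset Strict Implicit.
Unset Printing Implicit Defensive.
Import Order.TTheory GRing.Theory Num.Theory.
Import numFieldNormedType.Exports.
Local Open Scope classical_set_scope.
Local Open Scope ring_scope.

Definition mk_additive (A B : zmodType) (f : A -> B) (fB : zmod_morphism f)
  : {additive A -> B} :=
  HB.pack f (GRing.isZmodMorphism.Build A B f fB).

Section QuotientGroup.
Variable A : zmodType.

(* membership in the subgroup generated by S *)
Definition zspan (S : set A) : A -> bool := fun x =>
  `[< forall B : set A, B 0 -> (forall y z, B y -> B z -> B (y - z)) ->
        S `<=` B -> B x >].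

Fact zspan_closed S : zmod_closed (zspan S).
Proof.
split=> [|x y]; rewrite ?unfold_in; first exact/asboolP.
move=> Sx Sy; apply/asboolP=> B B0 BB SB.
by apply: (BB); [exact: (asboolW Sx) | exact: (asboolW Sy)].
Qed.
HB.instance Definition _ S := GRing.isZmodClosed.Build A (zspan S) (zspan_closed S).

Definition zspan_group (S : set A) : zmodClosed A := GRing.ZmodClosed.clone A (zspan S) _.

Definition quotg (S : set A) : zmodType := Quotient.quot (zspan_group S).

Definition qpi (S : set A) (x : A) : quotg S := \pi_(Quotient.quot (zspan_group S))%qT x.

Fact qpi_additive S : zmod_morphism (@qpi S).
Proof. by move=> x y; rewrite /qpi; rewrite !piE. Qed.
HB.instance Definition _ S :=
  GRing.isZmodMorphism.Build A (quotg S) (@qpi S) (@qpi_additive S).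

Lemma qpi_surj S (q : quotg S) : exists x, q = qpi S x.
Proof. by exists (repr (q : Quotient.quot (zspan_group S))); rewrite /qpi reprK. Qed.

Lemma qpi_eq0 S x : (qpi S x == 0) = zspan S x.
Proof.
have -> : 0 = qpi S 0 by rewrite raddf0.
have := Quotient.idealrBE (zspan_group S) x 0.
by rewrite subr0 => <-.
Qed.

Variables (S : set A) (B : zmodType) (f : {additive A -> B}).
Hypothesis fS : forall x, S x -> f x = 0.

Definition qlift_fun (q : quotg S) : B := f (repr (q : Quotient.quot (zspan_group S))).

Lemma qlift_funE x : qlift_fun (qpi S x) = f x.
Proof.
apply/eqP; rewrite -subr_eq0 -raddfB /=; set y := (y in y - x).
have : zspan S (y - x).
  rewrite -qpi_eq0 raddfB /= subr_eq0; apply/eqP.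
  by rewrite {1}/qpi /y reprK.
move=> /asboolW Syx; apply/eqP; apply: (Syx [set z | f z = 0]) => //=; first by rewrite raddf0.
by move=> u v; rewrite raddfB => -> ->; rewrite subrr.
Qed.

Fact qlift_additive : zmod_morphism qlift_fun.
Proof.
move=> p q; have [x ->] := qpi_surj p; have [y ->] := qpi_surj q.
by rewrite -raddfB /= !qlift_funE raddfB.
Qed.

Definition qlift : {additive quotg S -> B} := mk_additive qlift_additive.

Lemma qliftE x : qlift (qpi S x) = f x.
Proof. exact: qlift_funE. Qed.

End QuotientGroup.

Lemma quotg_ext (A B : zmodType) (S : set A) (f g : {additive quotg S -> B}) :
  (forall x, f (qpi S x) = g (qpi S x)) -> f =1 g.
Proof. by move=> fg q; have [x ->] := qpi_surj q. Qed.

Section FreeAbelianGroup.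
Variables (K : choiceType) (A : zmodType) (f : K -> A).

Fact zlift_additive :
  zmod_morphism (fglift (f : K -> ssrint.zmodule A) : {freeg K} -> A).
Proof. exact: (@lift_is_additive _ _ (ssrint.zmodule A)). Qed.

Definition zlift : {additive {freeg K} -> A} := mk_additive zlift_additive.

Lemma zliftE k x : zlift << k *g x >> = f x *~ k.
Proof. exact: (@liftU _ (ssrint.zmodule A)). Qed.

End FreeAbelianGroup.

Lemma freeg_ext (K : choiceType) (A : zmodType) (f g : {additive {freeg K} -> A}) :
  (forall x, f << x >> = g << x >>) -> f =1 g.
Proof.
move=> fg D; rewrite -[D]freeg_sumE !raddf_sum; apply: eq_bigr => x _.
by rewrite -[coeff x D]intz -freegU_mulz !raddfMz fg.
Qed.

(* Used below only with I finite, where it is the direct sum. *)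
Section Product.
Variables (I : Type) (T : I -> zmodType).

Definition dprod := forall i, T i.
HB.instance Definition _ := Choice.on dprod.

Definition dprod_add (x y : dprod) : dprod := fun i => x i + y i.
Definition dprod_opp (x : dprod) : dprod := fun i => - x i.
Definition dprod0 : dprod := fun=> 0.

Fact dprod_addA : associative dprod_add.
Proof. by move=> x y z; apply: functional_extensionality_dep => i; exact: addrA. Qed.
Fact dprod_addC : commutative dprod_add.
Proof. by move=> x y; apply: functional_extensionality_dep => i; exact: addrC. Qed.
Fact dprod_add0 : left_id dprod0 dprod_add.
Proof. by move=> x; apply: functional_extensionality_dep => i; exact: add0r. Qed.
Fact dprod_addN : left_inverse dprod0 dprod_opp dprod_add.
Proof. by move=> x; apply: functional_extensionality_dep => i; exact: addNr. Qed.

HB.instance Definition _ :=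
  GRing.isZmodule.Build dprod dprod_addA dprod_addC dprod_add0 dprod_addN.
End Product.

Section Kernel.
Variables (A B : zmodType) (f : {additive A -> B}).

Definition ker_pred : A -> bool := fun x => f x == 0.
Fact ker_closed : zmod_closed ker_pred.
Proof.
split=> [|x y]; rewrite !unfold_in /ker_pred ?raddf0//.
by rewrite raddfB => /eqP-> /eqP->; rewrite subrr.
Qed.
HB.instance Definition _ := GRing.isZmodClosed.Build A ker_pred ker_closed.

Definition kernel := {x : A | ker_pred x}.
HB.instance Definition _ := SubChoice.on kernel.
HB.instance Definition _ := [SubChoice_isSubZmodule of kernel by <:].
End Kernel.

Section Homz.
Variables (A B : zmodType).
Definition hom_pred : (A -> B) -> bool := fun f => `[< zmod_morphism f >].
Fact hom_closed : zmod_closed hom_pred.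
Proof.
split=> [|f g]; rewrite !unfold_in; first by apply/asboolP => x y; rewrite subr0.
move=> /asboolW fB /asboolW gB; apply/asboolP => x y.
by rewrite ![(f - g) _]/(f _ - g _) fB gB !opprD addrACA.
Qed.
HB.instance Definition _ := GRing.isZmodClosed.Build (A -> B) hom_pred hom_closed.
Definition homz := {f : A -> B | hom_pred f}.
HB.instance Definition _ := SubChoice.on homz.
HB.instance Definition _ := [SubChoice_isSubZmodule of homz by <:].

Definition homz_additive (f : homz) : {additive A -> B} :=
  mk_additive (asboolW (valP f)).
End Homz.
Section Subquotient.
Variables (A B C : zmodType) (f : {additive A -> B}) (g : {additive B -> C}).

(* ker g / im f *)
Definition homology_at : zmodType :=
  quotg [set z : kernel g | exists a, f a = val z].
End Subquotient.

Section SubquotientMap.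
Variables (A B C A' B' C' : zmodType).
Variables (f : {additive A -> B}) (g : {additive B -> C}).
Variables (f' : {additive A' -> B'}) (g' : {additive B' -> C'}).
Variable b : {additive B -> B'}.
Hypothesis bker : forall x, g x = 0 -> g' (b x) = 0.
Hypothesis bim : forall a, exists a', f' a' = b (f a).

Fact kermap_subproof (z : kernel g) : ker_pred g' (b (val z)).
Proof. by apply/eqP/bker/eqP; exact: (valP z). Qed.

Definition kermap_fun (z : kernel g) : homology_at f' g' :=
  qpi _ (Sub (b (val z)) (kermap_subproof z) : kernel g').

Fact kermap_additive : zmod_morphism kermap_fun.
Proof.
move=> x y; rewrite /kermap_fun -raddfB; congr (qpi _ _).
by apply: val_inj; rewrite /= !raddfB.
Qed.

Fact kermap_im (z : kernel g) :
  (exists a, f a = val z) -> mk_additive kermap_additive z = 0.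
Proof.
move=> [a az]; apply/eqP; rewrite [_ == _]qpi_eq0; apply/asboolP => U _ _; apply.
by rewrite /= -az; exact: bim.
Qed.

Definition homology_at_map : {additive homology_at f g -> homology_at f' g'} :=
  qlift kermap_im.
End SubquotientMap.

Record chain_complex := ChainComplex {
  ch :> nat -> zmodType;
  bd : forall n, {additive ch n.+1 -> ch n};
  bd_bd : forall n x, bd n (bd n.+1 x) = 0 }.

Record chain_map (C C' : chain_complex) := ChainMap {
  cm :> forall n, {additive C n -> C' n};
  cm_bd : forall n x, cm n (bd C n x) = bd C' n (cm n.+1 x) }.

Section Homology.
(* The differential leaving degree n; it is zero in degree 0. *)
Definition bd_out (C : chain_complex) n : {additive C n -> C n.-1} :=
  match n with 0 => \0 | m.+1 => bd C m end.

Definition homology (C : chain_complex) n := homology_at (bd C n) (bd_out C n).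

Variables (C C' : chain_complex) (phi : chain_map C C') (n : nat).

Fact homology_map_ker x : bd_out C n x = 0 -> bd_out C' n (phi n x) = 0.
Proof.
by case: n x => [|m] //= x bx; rewrite -cm_bd bx raddf0.
Qed.

Fact homology_map_im x : exists y, bd C' n y = phi n (bd C n x).
Proof. by exists (phi n.+1 x); rewrite cm_bd. Qed.

Definition homology_map : {additive homology C n -> homology C' n} :=
  homology_at_map homology_map_ker homology_map_im.
End Homology.

Section HomMap.
Variables (A A' B : zmodType) (f : {additive A -> A'}).

Fact homz_map_subproof (u : homz A' B) : hom_pred (val u \o f).
Proof.
by apply/asboolP => x y /=; rewrite raddfB; exact: (asboolW (valP u)).
Qed.

Definition homz_map_fun (u : homz A' B) : homz A B := Sub (val u \o f) (homz_map_subproof u).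

Fact homz_map_additive : zmod_morphism homz_map_fun.
Proof. by move=> u v; apply: val_inj; rewrite !raddfB. Qed.

Definition homz_map : {additive homz A' B -> homz A B} := mk_additive homz_map_additive.
End HomMap.

Section Cohomology.
Variable A : zmodType.

Definition cobd (C : chain_complex) n : {additive homz (C n) A -> homz (C n.+1) A} :=
  homz_map A (bd C n).

Definition cobd_in (C : chain_complex) n : {additive homz (C n.-1) A -> homz (C n) A} :=
  match n with 0 => \0 | m.+1 => cobd C m end.

Definition cohomology (C : chain_complex) n := homology_at (cobd_in C n) (cobd C n).

Variables (C C' : chain_complex) (phi : chain_map C C') (n : nat).

Lemma homz_map_cobd m (u : homz (C' m) A) :
  homz_map A (phi m.+1) (cobd C' m u) = cobd C m (homz_map A (phi m) u).
Proof.
by apply: val_inj; apply: functional_extensionality_dep => x /=; rewrite cm_bd.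
Qed.

Fact cohomology_map_ker (u : homz (C' n) A) :
  cobd C' n u = 0 -> cobd C n (homz_map A (phi n) u) = 0.
Proof. by move=> u0; rewrite -homz_map_cobd u0 raddf0. Qed.

Fact cohomology_map_im (u : homz (C' n.-1) A) :
  exists v, cobd_in C n v = homz_map A (phi n) (cobd_in C' n u).
Proof.
case: n u => [|m] u.
  by exists 0; rewrite raddf0 (_ : cobd_in C' 0 u = 0) // raddf0.
by exists (homz_map A (phi m) u); rewrite homz_map_cobd.
Qed.

Definition cohomology_map : {additive cohomology C' n -> cohomology C n} :=
  homology_at_map cohomology_map_ker cohomology_map_im.
End Cohomology.

Record gmodule (G : groupType) := GModule {
  gm_sort :> zmodType;
  gact : G -> {additive gm_sort -> gm_sort};
  gact1 : forall x, gact 1%g x = x;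
  gactM : forall g h x, gact (g * h)%g x = gact g (gact h x) }.
Arguments gact {G g} _ : rename.

Record gmap (G : groupType) (P Q : gmodule G) := GMap {
  gmap_fun :> {additive P -> Q};
  gmapE : forall g x, gmap_fun (gact g x) = gact g (gmap_fun x) }.

Record gcomplex (G : groupType) := GComplex {
  gch :> nat -> gmodule G;
  gbd : forall n, gmap (gch n.+1) (gch n);
  gbd_gbd : forall n x, gbd n (gbd n.+1 x) = 0 }.

Record gcomplex_map (G : groupType) (C C' : gcomplex G) := GComplexMap {
  gcm :> forall n, gmap (C n) (C' n);
  gcm_gbd : forall n x, gcm n (gbd C n x) = gbd C' n (gcm n.+1 x) }.

Section TrivialModule.
Variables (G : groupType) (A : zmodType).
Definition trivial_gmodule : gmodule G :=
  @GModule G A (fun=> idfun) (fun=> erefl) (fun _ _ _ => erefl).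
End TrivialModule.

Section GId.
Variables (G : groupType) (P : gmodule G).
Definition gid : gmap P P := @GMap G P P idfun (fun _ _ => erefl).
End GId.

(* Projectivity over the group ring Z[G], whose modules are the gmodules. *)
Definition projective (G : groupType) (P : gmodule G) :=
  forall (M N : gmodule G) (f : gmap M N) (u : gmap P N),
    (forall y, exists x, f x = y) -> exists v : gmap P M, forall x, f (v x) = u x.

Record projective_resolution (G : groupType) := ProjectiveResolution {
  res :> gcomplex G;
  res_aug : gmap (res 0) (trivial_gmodule G int);
  res_projective : forall n, projective (res n);
  res_aug_surj : forall k, exists x, res_aug x = k;
  res_aug_gbd : forall x, res_aug (gbd res 0 x) = 0;
  res_exact0 : forall x, res_aug x = 0 -> exists y, x = gbd res 0 y;
  res_exact : forall n x, gbd res n x = 0 -> exists y, x = gbd res n.+1 y }.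

Section Tensor.
Variables (G : groupType).

Section Def.
Variables (P C : gmodule G).
(* P (x)_G C for left G-modules P and C: the quotient of P (x)_Z C by the
   diagonal action, i.e. the tensor product over Z[G] once P is made a right
   module by p g := g^-1 p. *)
Variant tensor_rel : set {freeg (P * C)} :=
| TensorDl p p' c : tensor_rel (<< (p + p', c) >> - << (p, c) >> - << (p', c) >>)
| TensorDr p c c' : tensor_rel (<< (p, c + c') >> - << (p, c) >> - << (p, c') >>)
| TensorG g p c : tensor_rel (<< (gact g p, gact g c) >> - << (p, c) >>).

Definition tensor : zmodType := quotg tensor_rel.

Definition tens (p : P) (c : C) : tensor := qpi tensor_rel << (p, c) >>.

Lemma tensDl p p' c : tens (p + p') c = tens p c + tens p' c.
Proof.
apply/eqP; rewrite -subr_eq0 opprD addrA -!raddfB /= qpi_eq0.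
by apply/asboolP => U _ _; apply; exact: TensorDl.
Qed.

Lemma tensDr p c c' : tens p (c + c') = tens p c + tens p c'.
Proof.
apply/eqP; rewrite -subr_eq0 opprD addrA -!raddfB /= qpi_eq0.
by apply/asboolP => U _ _; apply; exact: TensorDr.
Qed.

Lemma tensG g p c : tens (gact g p) (gact g c) = tens p c.
Proof.
apply/eqP; rewrite -subr_eq0 -!raddfB /= qpi_eq0.
by apply/asboolP => U _ _; apply; exact: TensorG.
Qed.

Lemma tens0l c : tens 0 c = 0.
Proof. by apply: (addrI (tens 0 c)); rewrite -tensDl !addr0. Qed.
Lemma tens0r p : tens p 0 = 0.
Proof. by apply: (addrI (tens p 0)); rewrite -tensDr !addr0. Qed.

Lemma tensor_ext (B : zmodType) (f f' : {additive tensor -> B}) :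
  (forall p c, f (tens p c) = f' (tens p c)) -> f =1 f'.
Proof.
move=> ff'; apply: quotg_ext => x.
by apply: (@freeg_ext _ _ (f \o @qpi _ tensor_rel) (f' \o @qpi _ tensor_rel)) => -[p c]; exact: ff'.
Qed.
End Def.

Section Map.
Variables (P P' C C' : gmodule G) (u : gmap P P') (v : gmap C C').

Fact tensor_map_subproof x : tensor_rel x ->
  zlift (fun pc : P * C => tens (u pc.1) (v pc.2)) x = 0.
Proof.
by case=> *; rewrite !raddfB !zliftE !mulr1z /= ?raddfD ?tensDl ?tensDr ?gmapE ?tensG
  ?addrK ?subrr // -addrA -opprD subrr.
Qed.

Definition tensor_map : {additive tensor P C -> tensor P' C'} := qlift tensor_map_subproof.

Lemma tensor_mapE p c : tensor_map (tens p c) = tens (u p) (v c).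
Proof. by rewrite /tensor_map /tens qliftE zliftE mulr1z. Qed.
End Map.

Lemma tensor_map_comm (P P1 P2 P' C C1 C2 C' : gmodule G)
    (u1 : gmap P P1) (w1 : gmap P1 P') (u2 : gmap P P2) (w2 : gmap P2 P')
    (v1 : gmap C C1) (z1 : gmap C1 C') (v2 : gmap C C2) (z2 : gmap C2 C') x :
    (forall p, w1 (u1 p) = w2 (u2 p)) -> (forall c, z1 (v1 c) = z2 (v2 c)) ->
  tensor_map w1 z1 (tensor_map u1 v1 x) = tensor_map w2 z2 (tensor_map u2 v2 x).
Proof.
move=> uw vz.
apply: (@tensor_ext _ _ _ (tensor_map w1 z1 \o tensor_map u1 v1)
                          (tensor_map w2 z2 \o tensor_map u2 v2)) => p c.
rewrite -[LHS]/(tensor_map w1 z1 (tensor_map u1 v1 (tens p c))).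
rewrite -[RHS]/(tensor_map w2 z2 (tensor_map u2 v2 (tens p c))).
by rewrite !tensor_mapE uw vz.
Qed.

Lemma tensor_map0l (P P1 P' C C1 C' : gmodule G) (u : gmap P P1) (w : gmap P1 P')
    (v : gmap C C1) (z : gmap C1 C') x :
  (forall p, w (u p) = 0) -> tensor_map w z (tensor_map u v x) = 0.
Proof.
move=> uw; apply: (@tensor_ext _ _ _ (tensor_map w z \o tensor_map u v) \0) => p c.
rewrite -[LHS]/(tensor_map w z (tensor_map u v (tens p c))).
by rewrite !tensor_mapE uw tens0l.
Qed.

Lemma tensor_map0r (P P1 P' C C1 C' : gmodule G) (u : gmap P P1) (w : gmap P1 P')
    (v : gmap C C1) (z : gmap C1 C') x :
  (forall c, z (v c) = 0) -> tensor_map w z (tensor_map u v x) = 0.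
Proof.
move=> vz; apply: (@tensor_ext _ _ _ (tensor_map w z \o tensor_map u v) \0) => p c.
rewrite -[LHS]/(tensor_map w z (tensor_map u v (tens p c))).
by rewrite !tensor_mapE vz tens0r.
Qed.

Section Total.
Variables (P C : gcomplex G).

Definition tot_index (n : nat) := {pq : nat * nat | pq.1 + pq.2 == n}%N.

(* The sum over p + q = n of P_p (x)_G C_q, with d (x (x) y) =
   dx (x) y + (-1)^p x (x) dy. *)
Definition tot n : zmodType :=
  dprod (fun i : tot_index n => tensor (P (val i).1) (C (val i).2)).

Fact idx1_subproof n (i : tot_index n) : ((val i).1.+1 + (val i).2 == n.+1)%N.
Proof. by rewrite addSn eqSS; exact: (valP i). Qed.
Fact idx2_subproof n (i : tot_index n) : ((val i).1 + (val i).2.+1 == n.+1)%N.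
Proof. by rewrite addnS eqSS; exact: (valP i). Qed.

Definition idx1 n (i : tot_index n) : tot_index n.+1 :=
  exist _ ((val i).1.+1, (val i).2) (idx1_subproof i).
Definition idx2 n (i : tot_index n) : tot_index n.+1 :=
  exist _ ((val i).1, (val i).2.+1) (idx2_subproof i).

Definition tot_bd_fun n (x : tot n.+1) : tot n := fun i =>
  tensor_map (gbd P (val i).1) (gid (C (val i).2)) (x (idx1 i)) +
  tensor_map (gid (P (val i).1)) (gbd C (val i).2) (x (idx2 i)) *~ (-1) ^+ (val i).1.

Fact tot_bd_additive n : zmod_morphism (@tot_bd_fun n).
Proof.
move=> x y; apply: functional_extensionality_dep => i.
by rewrite /tot_bd_fun !raddfB /= mulrzBl opprD addrACA.
Qed.

Definition tot_bd n : {additive tot n.+1 -> tot n} := mk_additive (@tot_bd_additive n).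

Lemma tot_square p q (a b : tensor (P p.+1) (C q.+1)) : a = b ->
  tensor_map (gbd P p) (gid (C q)) (tensor_map (gid (P p.+1)) (gbd C q) a)
    *~ (-1) ^+ p.+1 +
  tensor_map (gid (P p)) (gbd C q) (tensor_map (gbd P p) (gid (C q.+1)) b)
    *~ (-1) ^+ p = 0.
Proof.
move=> ->; rewrite (tensor_map_comm (w2 := gid (P p)) (u2 := gbd P p)
  (z2 := gbd C q) (v2 := gid (C q.+1))) //.
by rewrite exprS mulN1r mulrNz addNr.
Qed.

Fact tot_bd_bd n x : tot_bd n (tot_bd n.+1 x) = 0.
Proof.
apply: functional_extensionality_dep => -[[p q] e].
rewrite -[LHS]/(tot_bd_fun (tot_bd_fun x) _) /tot_bd_fun.
rewrite !raddfD !raddfMz mulrzDl.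
rewrite [X in X + _ + _](tensor_map0l _ _ _ (@gbd_gbd _ P p)) add0r.
rewrite [X in _ + X *~ _ *~ _](tensor_map0r _ _ _ (@gbd_gbd _ C q)) !mul0rz addr0.
apply: (@tot_square p q).
have E (e1 e2 : (p.+1 + q.+1 == n.+2)%N) :
    x (exist _ (p.+1, q.+1) e1) = x (exist _ (p.+1, q.+1) e2).
  by rewrite (bool_irrelevance e1 e2).
exact: E.
Qed.

Definition total_complex := ChainComplex tot_bd_bd.
End Total.
End Tensor.

Section TotalMap.
Variables (G : groupType) (P : gcomplex G).

Section Map.
Variables (C C' : gcomplex G) (phi : gcomplex_map C C').

Definition tot_map_fun (n : nat) (x : tot P C n) : tot P C' n := fun i =>
  tensor_map (gid (P (val i).1)) (phi (val i).2) (x i).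

Fact tot_map_additive n : zmod_morphism (@tot_map_fun n).
Proof.
move=> x y; apply: functional_extensionality_dep => i.
by rewrite /tot_map_fun raddfB.
Qed.

Definition tot_map (n : nat) : {additive tot P C n -> tot P C' n} :=
  mk_additive (@tot_map_additive n).

Fact tot_map_bd n x : tot_map n (tot_bd P C n x) = tot_bd P C' n (tot_map n.+1 x).
Proof.
apply: functional_extensionality_dep => i.
rewrite -[LHS]/(tot_map_fun (tot_bd_fun x) i) -[RHS]/(tot_bd_fun (tot_map_fun x) i).
rewrite /tot_map_fun /tot_bd_fun raddfD raddfMz; congr (_ + _ *~ _).
  exact: tensor_map_comm.
by apply: tensor_map_comm => // c; exact: gcm_gbd.
Qed.

Definition total_map : chain_map (total_complex P C) (total_complex P C') :=
  @ChainMap (total_complex P C) (total_complex P C') tot_map tot_map_bd.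
End Map.

Definition Ztriv : gmodule G := trivial_gmodule G int.

Fact coinv_bd_bd n x :
  tensor_map (gbd P n) (gid Ztriv) (tensor_map (gbd P n.+1) (gid Ztriv) x) = 0.
Proof. by apply: tensor_map0l => p; exact: gbd_gbd. Qed.

(* P (x)_G Z *)
Definition coinvariant_complex : chain_complex :=
  @ChainComplex (fun n => tensor (P n) Ztriv) _ coinv_bd_bd.

(* The chain map from the total complex of P (x)_G C to P (x)_G Z induced by an
   augmentation eps : C_0 -> Z; it is zero on P_p (x)_G C_q for q > 0. *)
Section Augmentation.
Variables (C : gcomplex G) (eps : gmap (C 0%N) Ztriv).
Hypothesis eps_bd : forall x, eps (gbd C 0 x) = 0.

Definition corner n : tot_index n := exist _ (n, 0%N) (introT eqP (addn0 n)).

Definition tot_aug_fun (n : nat) (x : tot P C n) : coinvariant_complex n :=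
  tensor_map (gid (P n)) eps (x (corner n)).

Fact tot_aug_additive n : zmod_morphism (@tot_aug_fun n).
Proof. by move=> x y; rewrite /tot_aug_fun raddfB. Qed.

Definition tot_aug (n : nat) : {additive tot P C n -> coinvariant_complex n} :=
  mk_additive (@tot_aug_additive n).

Fact tot_aug_bd n x :
  tot_aug n (tot_bd P C n x) = bd coinvariant_complex n (tot_aug n.+1 x).
Proof.
rewrite -[LHS]/(tot_aug_fun (tot_bd_fun x)).
rewrite -[RHS]/(tensor_map (gbd P n) (gid Ztriv) (tot_aug_fun x)).
rewrite /tot_aug_fun /tot_bd_fun raddfD raddfMz.
rewrite [X in _ + X *~ _](tensor_map0r _ _ _ eps_bd) mul0rz addr0.
have E (e1 e2 : (n.+1 + 0 == n.+1)%N) :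
  x (exist _ (n.+1, 0%N) e1) = x (exist _ (n.+1, 0%N) e2).
  by rewrite (bool_irrelevance e1 e2).
rewrite [x (idx1 _)](E _ (introT eqP (addn0 n.+1))).
exact: tensor_map_comm.
Qed.

Definition total_aug : chain_map (total_complex P C) coinvariant_complex :=
  @ChainMap (total_complex P C) coinvariant_complex tot_aug tot_aug_bd.
End Augmentation.
End TotalMap.

Record sset := SSet {
  sx :> nat -> choiceType;
  sop : forall m n, {omorphism 'I_m.+1 -> 'I_n.+1} -> sx n -> sx m;
  sop_id : forall n x, sop (idfun : {omorphism 'I_n.+1 -> 'I_n.+1}) x = x;
  sop_comp : forall l m n (f : {omorphism 'I_m.+1 -> 'I_n.+1})
      (g : {omorphism 'I_l.+1 -> 'I_m.+1}) x,
    sop (f \o g : {omorphism _ -> _}) x = sop g (sop f x) }.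
Arguments sop {s m n} f x : rename.

Record smap (X Y : sset) := SMap {
  sm :> forall n, X n -> Y n;
  sm_op : forall m n (f : {omorphism 'I_m.+1 -> 'I_n.+1}) x, sm (sop f x) = sop f (sm x) }.

Lemma sop_eq (X : sset) m n (f g : {omorphism 'I_m.+1 -> 'I_n.+1}) (x : X n) :
  f =1 g -> sop f x = sop g x.
Proof.
move=> fg; suff -> : f = g by [].
case: f g fg => f [[fP]] [g [[gP]]] /= fg.
have {}fg : f = g by apply: functional_extensionality_dep.
by case: _ / fg gP => gP; rewrite (Prop_irrelevance fP gP).
Qed.

Section Face.
Variables (n : nat) (i : 'I_n.+2).
Definition face : 'I_n.+1 -> 'I_n.+2 := fintype.lift i.
Fact face_homo : {homo face : j k / (j <= k)%O}.
Proof. by move=> j k; rewrite !leEord /= leq_bump2. Qed.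
HB.instance Definition _ := Order.isOrderMorphism.Build _ _ _ _ face face_homo.
End Face.

Lemma alternating_sum (A : zmodType) N (a : nat -> nat -> A) :
  (forall i j, (i <= j < N)%N -> a i j.+1 = a j i) ->
  \sum_(j < N.+1) \sum_(i < N) a i j *~ (-1) ^+ (i + j) = 0.
Proof.
move=> aE.
have -> : \sum_(j < N.+1) \sum_(i < N) a i j *~ (-1) ^+ (i + j) =
  \sum_(i < N) \sum_(j < N.+1) a i j *~ (-1) ^+ (i + j) by rewrite exchange_big.
under eq_bigr => i _ do rewrite (bigID (fun j : 'I_N.+1 => (j <= i)%N)) /=.
rewrite big_split /=.
have -> : \sum_(i < N) \sum_(j < N.+1 | ~~ (j <= i)%N) a i j *~ (-1) ^+ (i + j) =
    - \sum_(i < N) \sum_(k < N | (i <= k)%N) a k i *~ (-1) ^+ (i + k).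
  rewrite -sumrN; apply: eq_bigr => i _.
  rewrite big_mkcond big_ord_recl /= add0r -big_mkcond /= -sumrN.
  apply: eq_big => k; rewrite -ltnNge /bump /= add1n ltnS // => ik.
  by rewrite aE ?ik //= addnS exprS mulN1r mulrNz.
apply/eqP; rewrite subr_eq0; apply/eqP.
under eq_bigr => i _ do rewrite big_mkcond big_ord_recr /= leqNgt ltn_ord addr0 -big_mkcond.
rewrite (exchange_big_dep predT) //=; apply: eq_bigr => j _.
by apply: eq_bigr => i _; rewrite addnC.
Qed.

Section Chains.
Variable X : sset.

Definition schain n : zmodType := {freeg (X n)}.

Definition schain_bd n : {additive schain n.+1 -> schain n} :=
  zlift (fun x => \sum_(i < n.+2) << (-1) ^+ i *g sop (face i) x >>).

Lemma schain_bdE n k x : schain_bd n << k *g x >> =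
  (\sum_(i < n.+2) << (-1) ^+ i *g sop (face i) x >>) *~ k.
Proof. exact: zliftE. Qed.

Fact schain_bd_bd n x : schain_bd n (schain_bd n.+1 x) = 0.
Proof.
apply: (@freeg_ext _ _ (schain_bd n \o schain_bd n.+1) \0) => {}x.
rewrite -[LHS]/(schain_bd n (schain_bd n.+1 << x >>)) -[RHS]/0.
rewrite zliftE mulr1z raddf_sum.
pose a i j : schain n := << sop (@face n (inord i)) (sop (@face n.+1 (inord j)) x) >>.
rewrite -[RHS](@alternating_sum _ n.+2 a).
  apply: eq_bigr => j _; rewrite zliftE mulrz_suml; apply: eq_bigr => i _.
  by rewrite /a !inord_val -[X in << X *g _ >>]intz -freegU_mulz exprD mulrzA.
move=> i j /andP[ij jn]; rewrite /a -!sop_comp.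
congr << _ >>; apply: sop_eq => k; apply: val_inj => /=.
have iN := leq_ltn_trans ij jn.
rewrite !inordK ?ltnS // ?(ltnW iN) // [RHS]bumpC.
have -> : unbump j i = i by rewrite /unbump ltnNge ij subn0.
by have -> : bump i j = j.+1 by rewrite /bump ij.
Qed.

Definition chains : chain_complex := ChainComplex schain_bd_bd.
End Chains.

Section ChainsMap.
Variables (X Y : sset) (f : smap X Y).

Definition schain_map n : {additive schain X n -> schain Y n} :=
  zlift (fun x => << f n x >>).

Lemma schain_mapE n k x : schain_map n << k *g x >> = << f n x >> *~ k.
Proof. exact: zliftE. Qed.

Fact schain_map_bd n x : schain_map n (schain_bd X n x) = schain_bd Y n (schain_map n.+1 x).
Proof.
apply: (@freeg_ext _ _ (schain_map n \o schain_bd X n) (schain_bd Y n \o schain_map n.+1)) => {}x.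
rewrite -[LHS]/(schain_map n (schain_bd X n << x >>)).
rewrite -[RHS]/(schain_bd Y n (schain_map n.+1 << x >>)).
rewrite schain_mapE !schain_bdE !mulr1z raddf_sum; apply: eq_bigr => i _.
by rewrite schain_mapE sm_op freegU_mulz intz.
Qed.

Definition chains_map : chain_map (chains X) (chains Y) :=
  @ChainMap (chains X) (chains Y) schain_map schain_map_bd.
End ChainsMap.

Record gsset (G : groupType) := GSset {
  gss :> sset;
  sact : G -> smap gss gss;
  sact1 : forall n (x : gss n), sact 1%g n x = x;
  sactM : forall g h n (x : gss n), sact (g * h)%g n x = sact g n (sact h n x) }.
Arguments sact {G g} _ : rename.

Record gsmap (G : groupType) (X Y : gsset G) := GSmap {
  gsm :> smap X Y;
  gsmE : forall g n (x : X n), gsm n (sact g n x) = sact g n (gsm n x) }.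

Section GChains.
Variables (G : groupType).

Section Obj.
Variable X : gsset G.

Fact gchain_act1 n (x : schain X n) : schain_map (sact (1%g : G)) n x = x.
Proof.
apply: (@freeg_ext _ _ (schain_map (sact (1%g : G)) n) idfun) => {}x.
by rewrite -[LHS]/(schain_map (sact (1%g : G)) n << x >>) schain_mapE mulr1z sact1.
Qed.

Fact gchain_actM n g h (x : schain X n) :
  schain_map (sact (g * h)%g) n x = schain_map (sact g) n (schain_map (sact h) n x).
Proof.
apply: (@freeg_ext _ _ (schain_map (sact (g * h)%g) n)
  (schain_map (sact g) n \o schain_map (sact h) n)) => {}x.
rewrite -[RHS]/(schain_map (sact g) n (schain_map (sact h) n << x >>)).
by rewrite !schain_mapE !mulr1z sactM.
Qed.

Definition gchain n : gmodule G :=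
  @GModule G (schain X n) (fun g => schain_map (sact g) n)
    (@gchain_act1 n) (@gchain_actM n).

Definition gchain_bd n : gmap (gchain n.+1) (gchain n) :=
  @GMap G (gchain n.+1) (gchain n) (schain_bd X n)
    (fun g x => esym (schain_map_bd (sact g) x)).

Definition gchains : gcomplex G :=
  @GComplex G gchain gchain_bd (@schain_bd_bd X).

Fact chain_aug_gmapE (g : G) (x : gchain 0) :
  zlift (fun=> 1 : int) (gact g x) = gact g (zlift (fun=> 1 : int) x : trivial_gmodule G int).
Proof.
apply: (@freeg_ext _ _ (zlift (fun=> 1 : int) \o schain_map (sact g) 0) (zlift (fun=> 1 : int))).
move=> {}x; rewrite -[LHS]/(zlift (fun=> 1 : int) (schain_map (sact g) 0 << x >>)).
by rewrite schain_mapE mulr1z !zliftE.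
Qed.

Definition chain_aug : gmap (gchains 0) (Ztriv G) :=
  @GMap G (gchains 0) (Ztriv G) (zlift (fun=> 1 : int)) chain_aug_gmapE.

Fact chain_aug_bd x : chain_aug (gbd gchains 0 x) = 0.
Proof.
apply: (@freeg_ext _ _ (zlift (fun=> 1 : int) \o schain_bd X 0) \0) => {}x.
rewrite -[LHS]/(zlift (fun=> 1 : int) (schain_bd X 0 << x >>)) -[RHS]/(0 : int).
by rewrite schain_bdE mulr1z big_ord_recl big_ord1 raddfD !zliftE.
Qed.
End Obj.

Section Map.
Variables (X Y : gsset G) (f : gsmap X Y).

Fact gchain_map_gmapE n g (x : gchain X n) :
  schain_map f n (gact g x) = gact g (schain_map f n x : gchain Y n).
Proof.
apply: (@freeg_ext _ _ (schain_map f n \o schain_map (sact g) n)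
  (schain_map (sact g) n \o schain_map f n)) => {}x.
rewrite -[LHS]/(schain_map f n (schain_map (sact g) n << x >>)).
rewrite -[RHS]/(schain_map (sact g) n (schain_map f n << x >>)).
by rewrite !schain_mapE !mulr1z gsmE.
Qed.

Definition gchain_map n : gmap (gchain X n) (gchain Y n) :=
  @GMap G (gchain X n) (gchain Y n) (schain_map f n) (@gchain_map_gmapE n).

Definition gchains_map : gcomplex_map (gchains X) (gchains Y) :=
  @GComplexMap G (gchains X) (gchains Y) gchain_map (@schain_map_bd X Y f).
End Map.
End GChains.

Record graph := Graph {
  vertex :> choiceType;
  edge : vertex -> vertex -> Prop;
  edge_sym : forall x y, edge x y -> edge y x;
  edge_irr : forall x, ~ edge x x }.
Arguments edge {g} x y : rename.

Definition point_graph : graph.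
Proof. by refine (@Graph unit (fun _ _ => False) _ _) => // ?. Defined.

Section FlagComplex.
Variable Gam : graph.

Definition flag k : set ('I_k.+1 -> Gam) :=
  [set x | forall mu nu : 'I_k.+1, (mu < nu)%N -> x mu = x nu \/ edge (x mu) (x nu)].

Definition Fl_simplex k : choiceType := set_type (@flag k).

Fact flag_comp m n (f : {omorphism 'I_m.+1 -> 'I_n.+1}) (x : Fl_simplex n) :
  val x \o f \in @flag m.
Proof.
rewrite inE => mu nu munu /=.
have : (f mu <= f nu)%O by apply: omorph_le; rewrite leEord ltnW.
rewrite leEord leq_eqVlt => /predU1P[/val_inj -> |]; first by left.
exact: (set_valP x).
Qed.

Definition Fl_op m n (f : {omorphism 'I_m.+1 -> 'I_n.+1}) (x : Fl_simplex n) : Fl_simplex m :=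
  exist _ (val x \o f) (flag_comp f x).

Definition Fl : sset.
Proof.
by refine (@SSet Fl_simplex Fl_op _ _) => *; apply: val_inj.
Defined.
End FlagComplex.

(* Edges may be collapsed, as simplices of Fl may have repeated vertices. *)
Record graph_map (Gam Gam' : graph) := GraphMap {
  gm_fun :> Gam -> Gam';
  gm_edge : forall x y, edge x y -> gm_fun x = gm_fun y \/ edge (gm_fun x) (gm_fun y) }.

Section FlMap.
Variables (Gam Gam' : graph) (f : graph_map Gam Gam').

Fact Fl_map_subproof k (x : Fl Gam k) : f \o val x \in @flag Gam' k.
Proof.
rewrite inE => mu nu munu /=.
by have [->|/gm_edge] := set_valP x mu nu munu; [left|].
Qed.

Definition Fl_map : smap (Fl Gam) (Fl Gam').
Proof.
refine (@SMap (Fl Gam) (Fl Gam') (fun k x => exist _ (f \o val x) (Fl_map_subproof x)) _).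
by move=> *; apply: val_inj.
Defined.
End FlMap.

Record ggraph (G : groupType) := GGraph {
  gg :> graph;
  vact : G -> graph_map gg gg;
  vact1 : forall x, vact 1%g x = x;
  vactM : forall g h x, vact (g * h)%g x = vact g (vact h x) }.
Arguments vact {G g} _ : rename.

Section GFl.
Variable G : groupType.

Definition gFl (Gam : ggraph G) : gsset G.
Proof.
refine (@GSset G (Fl Gam) (fun g => Fl_map (vact g)) _ _).
  by move=> n x; apply: val_inj; apply: functional_extensionality_dep => i /=; exact: vact1.
by move=> g h n x; apply: val_inj; apply: functional_extensionality_dep => i /=; exact: vactM.
Defined.

Definition id_graph_map (Gam : graph) : graph_map Gam Gam :=
  @GraphMap Gam Gam id (fun _ _ => @or_intror _ _).

Definition point_ggraph : ggraph G :=
  @GGraph G point_graph (fun=> id_graph_map point_graph) (fun=> erefl) (fun _ _ _ => erefl).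

Definition const_graph_map (Gam : graph) : graph_map Gam point_graph :=
  @GraphMap Gam point_graph (fun=> tt) (fun _ _ _ => or_introl erefl).

Definition Fl_const (Gam : ggraph G) : gsmap (gFl Gam) (gFl point_ggraph).
Proof.
refine (@GSmap G (gFl Gam) (gFl point_ggraph) (Fl_map (const_graph_map Gam)) _).
by move=> g n x; apply: val_inj.
Defined.
End GFl.

Section EquivariantHomology.
Variables (G : groupType) (P : projective_resolution G).

Definition eqv_homology (C : gcomplex G) n := homology (total_complex P C) n.

Definition eqv_cohomology (A : zmodType) (C : gcomplex G) n :=
  cohomology A (total_complex P C) n.

(* the homology and cohomology of P (x)_G Z and Hom(P (x)_G Z, A) *)
Definition group_homology n := homology (coinvariant_complex P) n.

Definition group_cohomology (A : zmodType) n :=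
  cohomology A (coinvariant_complex P) n.

Definition eqv_homology_map (X Y : gsset G) (f : gsmap X Y) n :
    {additive eqv_homology (gchains X) n -> eqv_homology (gchains Y) n} :=
  homology_map (total_map P (gchains_map f)) n.

Definition eqv_cohomology_map A (X Y : gsset G) (f : gsmap X Y) n :
    {additive eqv_cohomology A (gchains Y) n -> eqv_cohomology A (gchains X) n} :=
  cohomology_map A (total_map P (gchains_map f)) n.

Definition eqv_homology_aug (X : gsset G) n :
    {additive eqv_homology (gchains X) n -> group_homology n} :=
  homology_map (total_aug P (@chain_aug_bd G X)) n.

Definition eqv_cohomology_aug A (X : gsset G) n :
    {additive group_cohomology A n -> eqv_cohomology A (gchains X) n} :=
  cohomology_map A (total_aug P (@chain_aug_bd G X)) n.
End EquivariantHomology.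

(* having the homology of a point *)
Definition acyclic (X : sset) := forall n,
  exists f : {additive homology (chains X) n -> homology (chains (Fl point_graph)) n},
    bijective f.

Section Realization.
Variables (R : realType) (X : sset).

Definition std_simplex n : set 'rV[R]_n.+1 :=
  [set t | (forall i, 0 <= t 0 i) /\ \sum_i t 0 i = 1].

(* The disjoint union of the X_n x Delta^n with X_n discrete, presented as the
   sum over all simplices of X of a standard simplex. *)
Definition cells := {s : {n & X n} & set_type (@std_simplex (tag s))}.
HB.instance Definition _ := Topological.on cells.

Definition cell n (x : X n) (t : set_type (@std_simplex n)) : cells :=
  @existT {n & X n} (fun s => set_type (@std_simplex (tag s))) (existT _ n x) t.

(* The equivalence relation generated by (X(f) x, s) ~ (x, f_* s). *)
Inductive glue : cells -> cells -> Prop :=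
| Glue m n (f : {omorphism 'I_m.+1 -> 'I_n.+1}) (x : X n)
    (s : set_type (@std_simplex m)) (t : set_type (@std_simplex n)) :
    (forall j, val t 0 j = \sum_(i | f i == j) val s 0 i) ->
    glue (cell (sop f x) s) (cell x t)
| GlueRefl a : glue a a
| GlueSym a b : glue a b -> glue b a
| GlueTrans a b c : glue a b -> glue b c -> glue a c.

Fact glue_equiv : equiv_class_of (fun a b => `[< glue a b >]).
Proof.
split=> [a|a b|b a c]; first exact/asboolP/GlueRefl.
  by apply: asbool_equiv_eq; split; exact: GlueSym.
by move=> /asboolP ab /asboolP bc; apply/asboolP; exact: GlueTrans ab bc.
Qed.

Definition glue_rel : equiv_rel cells := EquivRelPack glue_equiv.

Definition realization : topologicalType := quotient_topology {eq_quot glue_rel}%qT.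
End Realization.

Definition contractible (R : realType) (T : topologicalType) :=
  exists (x0 : T) (H : T * R -> T),
    [/\ {within [set: T] `*` `[0, 1]%classic, continuous H},
        (forall x, H (x, 0) = x) & (forall x, H (x, 1) = x0)].

Record involution (D : nzRingType) := Involution {
  inv_fun :> D -> D;
  invD : {morph inv_fun : a b / a + b};
  invM : forall a b, inv_fun (a * b) = inv_fun b * inv_fun a;
  invK : involutive inv_fun }.

(* Right D-modules are left modules over the converse ring D^c. *)
Definition rscale (D : nzRingType) (M : lmodType D^c) (v : M) (a : D) : M :=
  (a : D^c) *: v.
Notation "v *>: a" := (rscale v a) (at level 40, left associativity) : ring_scope.

Section HermitianForm.
Variables (D : nzRingType) (J : involution D) (delta : D).

Record hermitian_form (M : lmodType D^c) := HermitianForm {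
  hform :> M -> M -> D;
  hformDl : forall u u' v, hform (u + u') v = hform u v + hform u' v;
  hformDr : forall u v v', hform u (v + v') = hform u v + hform u v';
  hformZ : forall u v a b, hform (u *>: a) (v *>: b) = J a * hform u v * b;
  hformJ : forall u v, hform u v = J (hform v u) * delta }.
End HermitianForm.

Lemma inv0 (D : nzRingType) (J : involution D) : J 0 = 0.
Proof. by apply: (addrI (J 0)); rewrite -invD !addr0. Qed.

Lemma inv1 (D : nzRingType) (J : involution D) : J 1 = 1.
Proof. by rewrite -[LHS]mul1r -{1}[1](invK J) -invM mul1r invK. Qed.

Section Dual.
Variables (D : nzRingType) (X : lmodType D^c).

Definition dual_pred : (X -> D) -> bool := fun xi =>
  `[< (forall u v, xi (u + v) = xi u + xi v) /\ (forall v a, xi (v *>: a) = xi v * a) >].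

Fact dual_closed : zmod_closed dual_pred.
Proof.
split=> [|f g]; rewrite !unfold_in.
  by apply/asboolP; split=> [u v|v a]; rewrite ?addr0 ?mul0r.
move=> /asboolW[fD fZ] /asboolW[gD gZ]; apply/asboolP.
split=> [u v|v a]; rewrite ![(f - g) _]/(f _ - g _).
  by rewrite fD gD opprD addrACA.
by rewrite fZ gZ mulrBl.
Qed.
HB.instance Definition _ := GRing.isZmodClosed.Build (X -> D) dual_pred dual_closed.

(* The carrier does not mention J; it is a parameter so that the right module
   structure (xi a)(v) = J a * xi v below can be attached to this type. *)
Definition right_dual (J : involution D) := {xi : X -> D | dual_pred xi}.

Variable J : involution D.
Local Notation dual := (right_dual J).

HB.instance Definition _ := SubChoice.on dual.
HB.instance Definition _ := [SubChoice_isSubZmodule of dual by <:].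

Fact dual_scale_subproof (a : D^c) (xi : dual) :
  dual_pred (fun v => J a * val xi v).
Proof.
have [xiD xiZ] := asboolW (valP xi).
by apply/asboolP; split=> [u v|v b]; rewrite ?xiD ?mulrDr ?xiZ ?mulrA.
Qed.

Definition dual_scale (a : D^c) (xi : dual) : dual :=
  Sub (fun v => J a * val xi v : D) (dual_scale_subproof a xi).

Fact dual_scaleA a b xi : dual_scale a (dual_scale b xi) = dual_scale (a * b) xi.
Proof.
apply: val_inj; apply: functional_extensionality_dep => v /=.
by rewrite mulrA -invM.
Qed.
Fact dual_scale1 : left_id 1 dual_scale.
Proof.
by move=> xi; apply: val_inj; apply: functional_extensionality_dep => v /=; rewrite inv1 mul1r.
Qed.
Fact dual_scaleDr : right_distributive dual_scale +%R.
Proof.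
by move=> a xi eta; apply: val_inj; apply: functional_extensionality_dep => v /=; exact: mulrDr.
Qed.
Fact dual_scaleDl xi : {morph dual_scale^~ xi : a b / a + b}.
Proof.
move=> a b; apply: val_inj; apply: functional_extensionality_dep => v /=.
by rewrite invD; exact: mulrDl.
Qed.
HB.instance Definition _ := GRing.Zmodule_isLmodule.Build D^c dual
  dual_scaleA dual_scale1 dual_scaleDr dual_scaleDl.
End Dual.

Section Hyperbolic.
Variables (D : nzRingType) (J : involution D) (delta : D).

Definition hyperbolic_form (X : lmodType D^c) (p q : X * right_dual X J) : D :=
  val p.2 q.1 + J (val q.2 p.1) * delta.

Definition hyperbolic (M : vectType D^c) (h : hermitian_form J delta M) :=
  exists (X : vectType D^c) (phi : {linear M -> (X * right_dual X J)%type}),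
    bijective phi /\ forall u v, h u v = hyperbolic_form (phi u) (phi v).
End Hyperbolic.

Section Isometries.
Variables (D : nzRingType) (J : involution D) (delta : D) (M : lmodType D^c).
Variable h : hermitian_form J delta M.

(* The inverse is data, but it is determined by iso_fun: see isometry_eq. *)
Record isometry := Isometry {
  iso_fun :> M -> M;
  iso_inv : M -> M;
  iso_funK : cancel iso_fun iso_inv;
  iso_invK : cancel iso_inv iso_fun;
  iso_linear : linear iso_fun;
  iso_form : forall u v, h (iso_fun u) (iso_fun v) = h u v }.

HB.instance Definition _ := gen_eqMixin isometry.
HB.instance Definition _ := gen_choiceMixin isometry.

Lemma isometry_eq (f g : isometry) : f =1 g -> f = g.
Proof.
case: f g => f f' fK f'K fL fh [g g' gK g'K gL gh] /= /funext fg; subst g.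
have f'g' : f' = g' by apply: funext => x; rewrite -[x in RHS]f'K gK.
by subst g'; congr Isometry; exact: Prop_irrelevance.
Qed.

Fact iso1_linear : linear (@id M). Proof. by []. Qed.
Definition iso1 : isometry :=
  @Isometry id id (fun=> erefl) (fun=> erefl) iso1_linear (fun _ _ => erefl).

Fact isoM_linear (f g : isometry) : linear (f \o g).
Proof. by move=> a u v; rewrite /= !iso_linear. Qed.
Fact isoM_form (f g : isometry) u v : h ((f \o g) u) ((f \o g) v) = h u v.
Proof. by rewrite /= !iso_form. Qed.
Definition isoM (f g : isometry) : isometry :=
  @Isometry (f \o g) (iso_inv g \o iso_inv f)
    (can_comp (@iso_funK f) (@iso_funK g)) (can_comp (@iso_invK g) (@iso_invK f))
    (@isoM_linear f g) (@isoM_form f g).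

Fact isoV_linear (f : isometry) : linear (iso_inv f).
Proof.
by move=> a u v; apply: (can_inj (@iso_funK f)); rewrite iso_linear !iso_invK.
Qed.
Fact isoV_form (f : isometry) u v : h (iso_inv f u) (iso_inv f v) = h u v.
Proof. by rewrite -(iso_form f) !iso_invK. Qed.
Definition isoV (f : isometry) : isometry :=
  @Isometry (iso_inv f) f (@iso_invK f) (@iso_funK f) (@isoV_linear f) (@isoV_form f).

Fact isoMA : associative isoM. Proof. by move=> f g k; exact: isometry_eq. Qed.
Fact iso1M : left_id iso1 isoM. Proof. by move=> f; exact: isometry_eq. Qed.
Fact isoM1 : right_id iso1 isoM. Proof. by move=> f; exact: isometry_eq. Qed.
Fact isoVM : left_inverse iso1 isoV isoM.
Proof. by move=> f; apply: isometry_eq => x; exact: iso_funK. Qed.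
Fact isoMV : right_inverse iso1 isoV isoM.
Proof. by move=> f; apply: isometry_eq => x; exact: iso_invK. Qed.
HB.instance Definition _ := isGroup.Build isometry isoMA iso1M isoM1 isoVM isoMV.

Definition unitary_group : groupType := isometry.

Definition perp (X : set M) : set M := [set v | forall u, X u -> h u v = 0].

Definition submodule (X : set M) :=
  [/\ X 0, forall u v, X u -> X v -> X (u + v) & forall u a, X u -> X (u *>: a)].

Definition lagrangian (X : set M) := submodule X /\ X = perp X.

Definition opposite (X Y : set M) := X `&` Y = [set 0].

Definition Lagrangians : choiceType := set_type [set X | lagrangian X].

Fact opposition_irr (X : Lagrangians) : ~ (val X != val X /\ opposite (val X) (val X)).
Proof. by move=> []; rewrite eqxx. Qed.
Fact opposition_sym (X Y : Lagrangians) :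
  val X != val Y /\ opposite (val X) (val Y) -> val Y != val X /\ opposite (val Y) (val X).
Proof. by rewrite /opposite setIC eq_sym. Qed.

Definition opposition_graph : graph := Graph opposition_sym opposition_irr.

Lemma iso_D (f : isometry) u v : f (u + v) = f u + f v.
Proof. by rewrite -[u]scale1r iso_linear !scale1r. Qed.
Lemma iso_0 (f : isometry) : f 0 = 0.
Proof. by apply: (addrI (f 0)); rewrite -iso_D !addr0. Qed.

Lemma iso_image_perp (f : isometry) X : f @` perp X = perp (f @` X).
Proof.
apply/seteqP; split=> [_ [v Xv <-] _ [u Xu <-]|w fXw].
  by rewrite iso_form; exact: Xv.
exists (iso_inv f w); last exact: iso_invK.
by move=> u Xu; rewrite -(iso_form f) iso_invK; apply: fXw; exists u.
Qed.

Fact iso_lagrangian (f : isometry) (X : Lagrangians) : f @` val X \in [set X | lagrangian X].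
Proof.
have [[X0 XD XZ] XP] := set_valP X.
have fD := iso_D f; have f0 := iso_0 f.
rewrite inE; split; last by rewrite -iso_image_perp -XP.
split; first by exists 0.
  by move=> _ _ [u Xu <-] [v Xv <-]; exists (u + v); [exact: XD|exact: fD].
move=> _ a [u Xu <-]; exists (u *>: a); first exact: XZ.
by rewrite /rscale -[_ *: u]addr0 iso_linear f0 addr0.
Qed.

Definition iso_act_fun (f : isometry) (X : Lagrangians) : Lagrangians :=
  exist _ (f @` val X) (iso_lagrangian f X).

Fact iso_act_edge (f : isometry) (X Y : opposition_graph) : edge X Y ->
  iso_act_fun f X = iso_act_fun f Y \/
  @edge opposition_graph (iso_act_fun f X) (iso_act_fun f Y).
Proof.
have fI := can_inj (@iso_funK f).
move=> [/= nXY XY]; right; split=> /=.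
  apply: contraNneq nXY => fXY.
  have imK A : iso_inv f @` (f @` A) = A.
    by rewrite image_comp (_ : _ \o _ = id) ?image_id//; apply: funext => x; exact: iso_funK.
  by rewrite -[val X]imK fXY imK.
have f0 := iso_0 f.
rewrite /opposite; apply/seteqP; split=> [_ [[u Xu <-] [v Yv vu]]|_ ->] /=.
  have : [set 0] u by rewrite -XY; split=> //; rewrite -(fI _ _ vu).
  by move=> ->.
have [X0 Y0] : (val X `&` val Y) 0 by rewrite XY.
by split; exists 0.
Qed.

Definition iso_act (f : isometry) : graph_map opposition_graph opposition_graph :=
  @GraphMap opposition_graph opposition_graph (iso_act_fun f) (@iso_act_edge f).

Fact iso_act1 (X : opposition_graph) : iso_act (1%g : isometry) X = X.
Proof. by apply: val_inj; exact: image_id. Qed.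

Fact iso_actM (f g : isometry) (X : opposition_graph) :
  iso_act (f * g)%g X = iso_act f (iso_act g X).
Proof. by apply: val_inj; rewrite /= image_comp. Qed.

Definition opposition_ggraph : ggraph unitary_group := GGraph iso_act1 iso_actM.
End Isometries.

(* Main.v *)
Require Import Defs.
From HB Require Import structures.
From mathcomp Require Import all_boot all_order all_algebra.
From mathcomp Require Import finmap wochoice.
From mathcomp Require Import all_classical reals topology normedtype.
From mathcomp Require Import generic_quotient freeg.
From mathcomp Require Import lra.
Set Implicit Arguments.
Unset Strict Implicit.
Unset Printing Implicit Defensive.
Import Order.TTheory GRing.Theory Num.Theory.
Import numFieldNormedType.Exports.
Import VectorInternalTheory.
Local Open Scope classical_set_scope.
Local Open Scope ring_scope.

(** Everything rests on one property of the opposition graph: finitely many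
    Lagrangians always have a common opposite Lagrangian (common_opposite).  Let Y be
    opposite to some of the given Lagrangians and meet a further one, X, in u <> 0.
    Choose z isotropic with h(z, u) = 1.  For a in D^eps the transvection
    v |-> v - z a h(z, v) is an isometry; for a <> 0 it moves Y to a Lagrangian whose
    intersection with X is smaller, and for all but at most one a it preserves each
    opposition already achieved.  As D^eps is infinite, a good a exists, and after
    finitely many steps Y is opposite to X too.

    Consequently every finite part of the flag complex lies in a cone.  Coning off a
    cycle shows that the augmented chain complex is exact (Fl_aug_exact), which gives
    acyclicity.

    For equivariant homology, the exact augmented chain complex is free and hence has
    an additive contraction k, in general not equivariant.  A projective module P_p is
    a retract of a free one, and on a free module k can be transported along the group
    to a contraction of P_p (x)_G C (twist).  So every column of the augmented double
    complex is contractible, and perturbing the column contractions by the horizontal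
    differential exhibits P (x)_G Z as a deformation retract of the total complex
    (columnwise_homology_bij, columnwise_cohomology_bij).  Additive homotopies survive
    Hom(-, A), so that cohomology needs no separate argument.  The map to the point is
    then an isomorphism because both augmentations are.

    For the geometric realization a contraction is written down (track_contractible).
    Choose a vertex v(S) for every finite set S of vertices, adjacent to the members of
    S and to v(T) for T in S (exists_apex).  For a point with masses w(x) on the
    vertices and a level that rises in time, the vertices with mass above the level
    are kept, and mass is put on those v(S) for which all masses in S exceed the total
    mass outside S and the level exceeds that outside mass.  The sets S that occur
    form a chain, so at each time the vertices carrying weight form a clique.  At the
    start the point is unchanged, at the end only v of the empty set is left.  Weights
    depend continuously on the point and on time, and points with given vertices and
    continuous weights move continuously (represents_continuous).  Since the
    realization is a quotient and the real line is locally compact, continuity on the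
    cells suffices (quotient_prod_continuous). *)

(** * Homology of chain complexes *)

Lemma additive_bij (A B : zmodType) (f : {additive A -> B}) :
  (forall x, f x = 0 -> x = 0) -> (forall y, exists x, f x = y) -> bijective f.
Proof.
move=> finj /choice[g gK]; exists g => // x.
by apply/eqP; rewrite -subr_eq0; apply/eqP/finj; rewrite raddfB gK subrr.
Qed.

Section HomologyAt.
Variables (A B C : zmodType) (f : {additive A -> B}) (g : {additive B -> C}).

Definition hclass (z : kernel g) : homology_at f g := qpi _ z.

Lemma hclass_surj (q : homology_at f g) : exists z, q = hclass z.
Proof. exact: qpi_surj. Qed.

Lemma hclass_eq0 (z : kernel g) : hclass z = 0 <-> exists a, f a = val z.
Proof.
split=> [/eqP|[a az]]; last first.
  by apply/eqP; rewrite [_ == _]qpi_eq0; apply/asboolP => U _ _; apply; exists a.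
rewrite [_ == _]qpi_eq0 => /asboolW/(_ [set z | exists a, f a = val z]).
apply=> [|y z' [a ay] [b bz]|//].
  by exists 0; rewrite !raddf0.
by exists (a - b); rewrite !raddfB ay bz.
Qed.

Lemma kernelP x : g x = 0 -> exists z : kernel g, val z = x.
Proof.
move=> gx; have kx : ker_pred g x by apply/eqP.
by exists (Sub x kx); rewrite SubK.
Qed.

Lemma kernel0 (z : kernel g) : g (val z) = 0.
Proof. exact/eqP/(valP z). Qed.
End HomologyAt.

Section HomologyAtMap.
Variables (A B C A' B' C' : zmodType).
Variables (f : {additive A -> B}) (g : {additive B -> C}).
Variables (f' : {additive A' -> B'}) (g' : {additive B' -> C'}).
Variable b : {additive B -> B'}.
Hypothesis bker : forall x, g x = 0 -> g' (b x) = 0.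
Hypothesis bim : forall a, exists a', f' a' = b (f a).

Lemma homology_at_map_class (z : kernel g) (z' : kernel g') :
  val z' = b (val z) -> homology_at_map bker bim (hclass f z) = hclass f' z'.
Proof.
move=> z'E; rewrite /homology_at_map /hclass qliftE; congr (qpi _ _).
by apply: val_inj; rewrite SubK z'E.
Qed.

(** Working with representatives here, once, keeps quotient types out of all the
    arguments below. *)
Lemma homology_at_map_bij :
  (forall x, g x = 0 -> (exists a', f' a' = b x) -> exists a, f a = x) ->
  (forall y, g' y = 0 -> exists x a', g x = 0 /\ y = b x + f' a') ->
  bijective (homology_at_map bker bim).
Proof.
move=> inj surj; apply: additive_bij => q.
  have [z ->] := hclass_surj q.
  have [z' z'E] := kernelP (bker (kernel0 z)).
  rewrite (homology_at_map_class z'E) => /hclass_eq0; rewrite z'E => bz.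
  by apply/hclass_eq0; apply: inj => //; exact: kernel0.
have [z' ->] := hclass_surj q.
have [x [a' [gx z'E]]] := surj _ (kernel0 z').
have [z zE] := kernelP gx.
have [z'' z''E] := kernelP (bker (kernel0 z)).
exists (hclass f z); rewrite (homology_at_map_class z''E).
apply/eqP; rewrite eq_sym -subr_eq0; apply/eqP.
have -> : hclass f' z' - hclass f' z'' = hclass f' (z' - z'').
  by rewrite /hclass raddfB.
apply/hclass_eq0; exists a'.
by rewrite raddfB /= z'E z''E zE addrAC subrr add0r.
Qed.
End HomologyAtMap.

Section HomologyComp.
Variables (C C' C'' : chain_complex) (phi : chain_map C C') (psi : chain_map C' C'')
  (chi : chain_map C C'').
Hypothesis chiE : forall n x, psi n (phi n x) = chi n x.

Lemma homology_map_comp n q :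
  homology_map psi n (homology_map phi n q) = homology_map chi n q.
Proof.
have [z ->] := hclass_surj q.
have [z' z'E] := kernelP (homology_map_ker phi (kernel0 z)).
have [z'' z''E] := kernelP (homology_map_ker chi (kernel0 z)).
rewrite [homology_map phi n _](homology_at_map_class _ _ z'E).
rewrite [RHS](homology_at_map_class _ _ z''E).
by apply: homology_at_map_class; rewrite z'E z''E chiE.
Qed.

Lemma cohomology_map_comp A n q :
  cohomology_map A phi n (cohomology_map A psi n q) = cohomology_map A chi n q.
Proof.
have [z ->] := hclass_surj q.
have [z' z'E] := kernelP (cohomology_map_ker psi (kernel0 z)).
have [z'' z''E] := kernelP (cohomology_map_ker chi (kernel0 z)).
rewrite [cohomology_map A psi n _](homology_at_map_class _ _ z'E).
rewrite [RHS](homology_at_map_class _ _ z''E).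
apply: homology_at_map_class; rewrite z'E z''E; apply: val_inj.
by apply: functional_extensionality_dep => x /=; rewrite chiE.
Qed.
End HomologyComp.

(** A map onto a complex with a section that is an inverse up to chain homotopy.
    The data are additive, so that they survive composition with Hom(-, A):
    this is why it controls cohomology with every coefficient group. *)
Section DeformationRetract.
Variables (C C' : chain_complex) (phi : chain_map C C').
Variable psi : forall n, {additive C' n -> C n}.
Variable s : forall n, {additive C n -> C n.+1}.
Hypothesis psi_bd : forall n x, psi n (bd C' n x) = bd C n (psi n.+1 x).
Hypothesis phiK : forall n x, phi n (psi n x) = x.
Hypothesis s0 : forall x, x - psi 0 (phi 0 x) = bd C 0 (s 0 x).
Hypothesis sS : forall n x,
  x - psi n.+1 (phi n.+1 x) = bd C n.+1 (s n.+1 x) + s n (bd C n x).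

Lemma psi_bd_out n x : bd_out C' n x = 0 -> bd_out C n (psi n x) = 0.
Proof. by case: n x => // n x /= bx; rewrite -psi_bd bx raddf0. Qed.

Lemma retract_homology_bij n : bijective (homology_map phi n).
Proof.
apply: homology_at_map_bij => [x bx [y yE]|y bx]; last first.
  exists (psi n y), 0; split; first exact: psi_bd_out.
  by rewrite phiK raddf0 addr0.
exists (psi n.+1 y + s n x).
rewrite raddfD -psi_bd yE addrC.
case: n {y yE} x bx => [|n] x bx; first by rewrite -s0 subrK.
by have := sS x; rewrite bx raddf0 addr0 => <-; rewrite subrK.
Qed.

Variable A : zmodType.

Lemma homz_eq (B : zmodType) (u v : homz B A) : val u =1 val v -> u = v.
Proof. by move=> uv; apply: val_inj; exact: functional_extensionality_dep. Qed.

Lemma homzB (B : zmodType) (u : homz B A) : zmod_morphism (val u).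
Proof. exact: (asboolW (valP u)). Qed.

Lemma retract_cohomology_bij n : bijective (cohomology_map A phi n).
Proof.
apply: homology_at_map_bij => [u bu|u bu].
  case: n u bu => [|n] u bu [w wE].
    exists 0; rewrite raddf0; apply: homz_eq => x.
    by rewrite -[x in RHS]phiK; have := congr1 (fun f : homz _ _ => val f (psi 0 x)) wE.
  exists (homz_map A (psi n) w); apply: homz_eq => x.
  have := congr1 (fun f : homz _ _ => val f (psi n.+1 x)) wE.
  by rewrite /= phiK psi_bd.
have cu x : val u (bd C n x) = 0.
  exact: (congr1 (fun f : homz _ _ => val f x) bu).
have cpsi : cobd A C' n (homz_map A (psi n) u) = 0.
  by apply: homz_eq => x /=; rewrite psi_bd cu.
exists (homz_map A (psi n) u).
have uB := homzB u; have uD x y : val u (x + y) = val u x + val u y.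
  exact: (raddfD (mk_additive uB)).
case: n u bu cu cpsi uB uD => [|n] u bu cu cpsi uB uD.
  exists 0; split => //; rewrite raddf0 addr0; apply: homz_eq => x.
  apply/eqP; rewrite -subr_eq0 -[_ - _]/(val u x - val u (psi 0 (phi 0 x))) -uB.
  by rewrite s0 cu.
exists (homz_map A (s n) u); split => //; apply: homz_eq => x.
rewrite -[RHS]/(val u (psi n.+1 (phi n.+1 x)) + val u (s n (bd C n x))).
by apply/eqP; rewrite addrC -subr_eq -uB sS uD cu add0r.
Qed.
End DeformationRetract.

(** * Double complexes with contractible columns *)

Section DoubleComplex.
Variables (D : nat -> nat -> zmodType) (B : nat -> zmodType).
Variables (dh : forall p q, {additive D p.+1 q -> D p q})
  (dv : forall p q, {additive D p q.+1 -> D p q})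
  (dB : forall p, {additive B p.+1 -> B p})
  (e : forall p, {additive D p 0 -> B p}).
Hypothesis dh_dh : forall p q x, dh p q (dh p.+1 q x) = 0.
Hypothesis dh_dv : forall p q x, dh p q (dv p.+1 q x) = - dv p q (dh p q.+1 x).
Hypothesis e_dh : forall p x, e p (dh p 0 x) = dB p (e p.+1 x).
Variables (eta : forall p, {additive B p -> D p 0})
  (K : forall p q, {additive D p q -> D p q.+1}).
Hypothesis etaK : forall p b, e p (eta p b) = b.
Hypothesis K0 : forall p x, dv p 0 (K p 0 x) + eta p (e p x) = x.
Hypothesis KS : forall p q x, dv p q.+1 (K p q.+1 x) + K p q (dv p q x) = x.

Definition family := forall p q, D p q.
Definition fam_bd (x : family) : family := fun p q => dh p q (x p.+1 q) + dv p q (x p q.+1).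

(** The two recursions solve the total differential column by column; they run
    along q, so that no bound on p + q is needed.  Writing dh and K for the
    horizontal differential and the contraction, they are the perturbation
    series (1 + K dh)^-1 eta and (1 + K dh)^-1 K. *)
Fixpoint fam_section (b : forall p, B p) q : forall p, D p q :=
  match q with
  | 0 => fun p => eta p (b p)
  | q'.+1 => fun p => - K p q' (dh p q' (fam_section b q' p.+1))
  end.

Fixpoint fam_homotopy (x : family) q : forall p, D p q :=
  match q with
  | 0 => fun p => 0
  | q'.+1 => fun p => K p q' (x p q' - dh p q' (fam_homotopy x q' p.+1))
  end.

Lemma fam_sectionS b q p :
  fam_section b q.+1 p = - K p q (dh p q (fam_section b q p.+1)).
Proof. by []. Qed.

Lemma fam_homotopyS x q p :
  fam_homotopy x q.+1 p = K p q (x p q - dh p q (fam_homotopy x q p.+1)).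
Proof. by []. Qed.

Let dvK0 p x : dv p 0 (K p 0 x) = x - eta p (e p x).
Proof. by apply/eqP; rewrite eq_sym subr_eq K0. Qed.

Let dvKS p q x : dv p q.+1 (K p q.+1 x) = x - K p q (dv p q x).
Proof. by apply/eqP; rewrite eq_sym subr_eq KS. Qed.

(** Induction on q: the contraction trades the vertical differential of the new
    component for the defect one column further right, where the claim is known. *)
Lemma fam_section_bd b p q :
  dh p q (fam_section b q p.+1) + dv p q (fam_section b q.+1 p) =
  fam_section (fun p => dB p (b p.+1)) q p.
Proof.
elim: q p => [|q IH] p.
  by rewrite /= raddfN dvK0 e_dh etaK opprB addrC subrK.
rewrite [fam_section _ q.+2 _]/= raddfN dvKS opprB addrC subrK.
have -> : dv p q (dh p q.+1 (fam_section b q.+1 p.+1)) =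
    - dh p q (dv p.+1 q (fam_section b q.+1 p.+1)) by rewrite dh_dv opprK.
have -> : dv p.+1 q (fam_section b q.+1 p.+1) =
    fam_section (fun p => dB p (b p.+1)) q p.+1 - dh p.+1 q (fam_section b q p.+2).
  by rewrite -IH addrC addKr.
by rewrite raddfB dh_dh subr0 raddfN.
Qed.

Lemma fam_homotopy_bd x p q :
  dh p q (fam_homotopy x q p.+1) + dv p q (fam_homotopy x q.+1 p)
    + fam_homotopy (fam_bd x) q p =
  x p q - fam_section (fun p => e p (x p 0)) q p.
Proof.
elim: q p => [|q IH] p; first by rewrite /= !(raddf0, add0r, addr0) dvK0.
set h := fam_homotopy x q.+1 p.+1; pose a := fam_section (fun p => e p (x p 0)) q p.+1.
have {}IH : fam_homotopy (fam_bd x) q p.+1 =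
    x p.+1 q - a - (dh p.+1 q (fam_homotopy x q p.+2) + dv p.+1 q h).
  by rewrite -IH addrC addKr.
have -> : fam_homotopy x q.+2 p = K p q.+1 (x p q.+1 - dh p q.+1 h) by [].
have -> : fam_homotopy (fam_bd x) q.+1 p =
    K p q (fam_bd x p q - dh p q (fam_homotopy (fam_bd x) q p.+1)) by [].
have -> : fam_section (fun p => e p (x p 0)) q.+1 p = - K p q (dh p q a) by [].
rewrite IH dvKS; set u := x p q.+1 - _.
have -> : fam_bd x p q - dh p q
    (x p.+1 q - a - (dh p.+1 q (fam_homotopy x q p.+2) + dv p.+1 q h)) =
    dv p q u + dh p q a.
  rewrite /u !(raddfB (dh p q)) (raddfB (dv p q)) (raddfD (dh p q)) dh_dh dh_dv.
  rewrite add0r opprD opprB opprK /fam_bd addrA.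
  by rewrite [dh p q _ + dv p q _]addrC [dh p q a - _]addrC addrA addrK addrAC.
rewrite opprK (raddfD (K p q)) -addrA [X in _ + X]addrA subrK addrA /u.
by rewrite [dh p q.+1 h + _]addrC subrK.
Qed.
End DoubleComplex.

(** Contractions of the single columns, with no compatibility between different
    columns, already make the total complex retract onto P (x)_G Z. *)
Section ColumnwiseRetract.
Variables (G : groupType) (P C : gcomplex G) (eps : gmap (C 0) (Ztriv G)).
Hypothesis eps_bd : forall x, eps (gbd C 0 x) = 0.
Variables (eta : forall p, {additive tensor (P p) (Ztriv G) -> tensor (P p) (C 0)})
  (K : forall p q, {additive tensor (P p) (C q) -> tensor (P p) (C q.+1)}).
Hypothesis etaK : forall p b, tensor_map (gid (P p)) eps (eta p b) = b.
Hypothesis K0 : forall p x,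
  tensor_map (gid (P p)) (gbd C 0) (K p 0 x)
    + eta p (tensor_map (gid (P p)) eps x) = x.
Hypothesis KS : forall p q x,
  tensor_map (gid (P p)) (gbd C q.+1) (K p q.+1 x)
    + K p q (tensor_map (gid (P p)) (gbd C q) x) = x.

Let D p q : zmodType := tensor (P p) (C q).
Let B p : zmodType := tensor (P p) (Ztriv G).
Let dh p q : {additive D p.+1 q -> D p q} := tensor_map (gbd P p) (gid (C q)).
Let dB p : {additive B p.+1 -> B p} := tensor_map (gbd P p) (gid (Ztriv G)).
Let e p : {additive D p 0 -> B p} := tensor_map (gid (P p)) eps.

Fact signed_additive (U V : zmodType) (f : {additive U -> V}) p :
  zmod_morphism (fun x => f x *~ (-1) ^+ p).
Proof. by move=> x y; rewrite raddfB mulrzBl. Qed.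
Let signed (U V : zmodType) f p : {additive U -> V} := mk_additive (@signed_additive U V f p).

(* The sign of the total differential is absorbed into dv and into K, so that
   dh and dv anticommute and K still contracts the columns. *)
Let dv p q : {additive D p q.+1 -> D p q} :=
  signed (tensor_map (gid (P p)) (gbd C q)) p.
Let K' p q : {additive D p q -> D p q.+1} := signed (K p q) p.

Let signK (V : zmodType) (v : V) p : v *~ (-1) ^+ p *~ (-1) ^+ p = v.
Proof. by rewrite -mulrzA -expr2 sqrr_sign mulr1z. Qed.

Let dh_dh p q x : dh p q (dh p.+1 q x) = 0.
Proof. by apply: tensor_map0l => y; exact: gbd_gbd. Qed.

Let dh_dv p q x : dh p q (dv p.+1 q x) = - dv p q (dh p q.+1 x).
Proof.
rewrite -[dv _ _ _]/(_ *~ _) -[dv p q _]/(_ *~ _) raddfMz exprS mulN1r mulrNz.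
by congr (- (_ *~ _)); exact: tensor_map_comm.
Qed.

Let e_dh p x : e p (dh p 0 x) = dB p (e p.+1 x).
Proof. exact: tensor_map_comm. Qed.

Let K'0 p x : dv p 0 (K' p 0 x) + eta p (e p x) = x.
Proof. by rewrite -[dv _ _ _]/(_ *~ _) -[K' p 0 x]/(_ *~ _) raddfMz signK K0. Qed.

Let K'S p q x : dv p q.+1 (K' p q.+1 x) + K' p q (dv p q x) = x.
Proof.
rewrite -[dv p q.+1 _]/(_ *~ _) -[K' p q.+1 x]/(_ *~ _) raddfMz signK.
by rewrite -[K' p q _]/(_ *~ _) -[dv p q _]/(_ *~ _) raddfMz signK KS.
Qed.

Definition tot_at n (x : tot P C n) p q (pq : (p + q = n)%N) : D p q :=
  x (exist _ (p, q) (introT eqP pq)).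

(** The recursions above run over all bidegrees at once, so an element of total
    degree n is extended by zero; this avoids casts between total degrees. *)
Definition tot_ext n (x : tot P C n) : family D := fun p q =>
  if @eqP _ (p + q)%N n is ReflectT pq then tot_at x pq else 0.

Definition coinv_ext n (b : B n) p : B p :=
  if @eqP _ n p is ReflectT np then ecast k (B k) np b else 0.

Lemma tot_extE n (x : tot P C n) (i : tot_index n) : tot_ext x (val i).1 (val i).2 = x i.
Proof.
case: i => -[p q] pq; rewrite /tot_ext /=; case: eqP => [pq'|[]]; last exact/eqP.
by rewrite /tot_at (bool_irrelevance pq (introT eqP pq')).
Qed.

Lemma tot_ext_bd n (x : tot P C n.+1) :
  fam_bd dh dv (tot_ext x) = tot_ext (tot_bd P C n x).
Proof.
apply: functional_extensionality_dep => p; apply: functional_extensionality_dep => q.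
rewrite /fam_bd /tot_ext; case: (@eqP _ (p + q)%N n) => pq.
  case: eqP => pq1; last by case: pq1; rewrite addSn pq.
  case: eqP => pq2; last by case: pq2; rewrite addnS pq.
  have E r (r1 r2 : (r.1 + r.2 == n.+1)%N) : x (exist _ r r1) = x (exist _ r r2).
    by rewrite (bool_irrelevance r1 r2).
  rewrite /tot_at; apply: f_equal2; first by apply: (congr1 (dh p q)); exact: (E (_, _)).
  by apply: (congr1 (dv p q)); exact: (E (_, _)).
case: eqP => pq1; first by case: pq; move: pq1; rewrite addSn => -[].
case: eqP => pq2; first by case: pq; move: pq2; rewrite addnS => -[].
by rewrite !raddf0 addr0.
Qed.

Lemma coinv_extE n (b : B n) : coinv_ext b n = b.
Proof. by rewrite /coinv_ext; case: eqP => // nn; rewrite eq_axiomK. Qed.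

Lemma coinv_ext_bd n (b : B n.+1) :
  coinv_ext (dB n b) = fun p => dB p (coinv_ext b p.+1).
Proof.
apply: functional_extensionality_dep => p; rewrite /coinv_ext.
case: (@eqP _ n p) => [np|np]; case: eqP => [np1|np1].
- by subst p; rewrite [np1]eq_axiomK.
- by case: np1; rewrite np.
- by case: np; case: np1.
- by rewrite raddf0.
Qed.

Lemma coinv_ext_aug n (x : tot P C n) :
  coinv_ext (tot_aug_fun eps x) = fun p => e p (tot_ext x p 0).
Proof.
apply: functional_extensionality_dep => p; rewrite /coinv_ext /tot_ext.
case: (@eqP _ n p) => [np|np]; case: eqP => [pn|pn].
- subst p; rewrite /= /tot_aug_fun /corner /tot_at.
  by rewrite (bool_irrelevance (introT eqP (addn0 n)) (introT eqP pn)).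
- by case: pn; rewrite addn0 np.
- by case: np; rewrite addn0 in pn.
- by rewrite raddf0.
Qed.

Definition tot_section_fun n (b : B n) : tot P C n :=
  fun i => fam_section dh eta K' (coinv_ext b) (val i).2 (val i).1.

Definition tot_homotopy_fun n (x : tot P C n) : tot P C n.+1 :=
  fun i => fam_homotopy dh K' (tot_ext x) (val i).2 (val i).1.

Fact tot_section_additive n : zmod_morphism (@tot_section_fun n).
Proof.
move=> b c; apply: functional_extensionality_dep => -[[p q] pq].
rewrite -[RHS]/(fam_section dh eta K' (coinv_ext b) q p
  - fam_section dh eta K' (coinv_ext c) q p) /tot_section_fun /=.
elim: q p {pq} => [|q IH] p.
  2: by rewrite !fam_sectionS IH (raddfB (dh p q)) (raddfB (K' p q)) opprB addrC opprK.
rewrite -[RHS](raddfB (eta p)); congr (eta _ _); rewrite /coinv_ext.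
by case: eqP => [np|]; rewrite ?subr0 //; subst p.
Qed.

Fact tot_homotopy_additive n : zmod_morphism (@tot_homotopy_fun n).
Proof.
move=> x y; apply: functional_extensionality_dep => -[[p q] pq].
rewrite -[RHS]/(fam_homotopy dh K' (tot_ext x) q p
  - fam_homotopy dh K' (tot_ext y) q p) /tot_homotopy_fun /=.
have E r s : tot_ext (x - y) r s = tot_ext x r s - tot_ext y r s.
  by rewrite /tot_ext; case: eqP => // _; rewrite subr0.
elim: q p {pq} => [|q IH] p; first by rewrite [RHS]subr0.
rewrite !fam_homotopyS IH E -[RHS](raddfB (K' p q)); congr (K' _ _ _).
by rewrite (raddfB (dh p q)) !opprB addrACA [RHS]addrACA [in LHS](addrC (- _)).
Qed.

Let psi n : {additive coinvariant_complex P n -> total_complex P C n} :=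
  mk_additive (@tot_section_additive n).
Let s n : {additive total_complex P C n -> total_complex P C n.+1} :=
  mk_additive (@tot_homotopy_additive n).
Let phi := total_aug P eps_bd.

Lemma tot_section_bd n b :
  psi n (bd (coinvariant_complex P) n b) = bd (total_complex P C) n (psi n.+1 b).
Proof.
apply: functional_extensionality_dep => -[[p q] pq].
rewrite -[LHS]/(fam_section dh eta K' (coinv_ext (dB n b)) q p) coinv_ext_bd.
by rewrite -(fam_section_bd dh_dh dh_dv e_dh etaK K'0 K'S).
Qed.

Lemma tot_sectionK n b : phi n (psi n b) = b.
Proof.
rewrite -[LHS]/(tensor_map (gid (P n)) eps (eta n (coinv_ext b n))).
by rewrite etaK coinv_extE.
Qed.

Let homotopyE n (x : tot P C n) (i : tot_index n) :
  tot_bd P C n (s n x) i + fam_homotopy dh K' (fam_bd dh dv (tot_ext x)) (val i).2 (val i).1 =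
  x i - psi n (phi n x) i.
Proof.
rewrite -[psi n _ i]/(fam_section dh eta K' (coinv_ext (tot_aug_fun eps x)) _ _).
rewrite coinv_ext_aug -[in RHS]tot_extE.
by rewrite -(fam_homotopy_bd dh_dh dh_dv K'0 K'S).
Qed.

Lemma tot_homotopy0 x : x - psi 0 (phi 0 x) = bd (total_complex P C) 0 (s 0 x).
Proof.
apply: functional_extensionality_dep => i; rewrite -[LHS]/(x i - psi 0 (phi 0 x) i).
rewrite -homotopyE; case: i => -[[|p] [|q]] // i /=.
by rewrite addr0.
Qed.

Lemma tot_homotopyS n x : x - psi n.+1 (phi n.+1 x) =
  bd (total_complex P C) n.+1 (s n.+1 x) + s n (bd (total_complex P C) n x).
Proof.
apply: functional_extensionality_dep => i.
rewrite -[LHS]/(x i - psi n.+1 (phi n.+1 x) i) -homotopyE tot_ext_bd.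
by [].
Qed.

Lemma columnwise_homology_bij n : bijective (homology_map phi n).
Proof. exact: retract_homology_bij tot_section_bd tot_sectionK tot_homotopy0 tot_homotopyS n. Qed.

Lemma columnwise_cohomology_bij A n : bijective (cohomology_map A phi n).
Proof.
exact: retract_cohomology_bij tot_section_bd tot_sectionK tot_homotopy0 tot_homotopyS A n.
Qed.
End ColumnwiseRetract.

(** * Contractions of columns from projectivity *)

Lemma zlift_eq (K : choiceType) (A : zmodType) (f g : K -> A) :
  f =1 g -> zlift f =1 zlift g.
Proof. by move=> fg; apply: freeg_ext => x; rewrite !zliftE fg. Qed.

Lemma zliftD (K : choiceType) (A : zmodType) (f g : K -> A) x :
  zlift (fun k => f k + g k) x = zlift f x + zlift g x.
Proof.
move: x; apply: (@freeg_ext _ _ (zlift _) (zlift f \+ zlift g)) => x.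
by rewrite -[RHS]/(zlift f << x >> + zlift g << x >>) !zliftE !mulr1z.
Qed.

Lemma zlift_comp (K : choiceType) (A B : zmodType) (f : K -> A) (u : {additive A -> B}) x :
  u (zlift f x) = zlift (fun k => u (f k)) x.
Proof.
move: x; apply: (@freeg_ext _ _ (u \o zlift f)) => x.
by rewrite -[LHS]/(u (zlift f << x >>)) !zliftE !mulr1z.
Qed.

Lemma zlift_zlift (K L : choiceType) (A : zmodType) (f : K -> A) (s : L -> K) x :
  zlift f (zlift (fun l => << s l >>) x) = zlift (fun l => f (s l)) x.
Proof. by rewrite zlift_comp; apply: zlift_eq => l; rewrite zliftE mulr1z. Qed.

Section FreeCover.
Variables (G : groupType) (P : gmodule G).

Definition free_act (g : G) : {additive {freeg (G * P)} -> {freeg (G * P)}} :=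
  zlift (fun hp : G * P => << ((g * hp.1)%g, hp.2) >>).

Fact free_act1 x : free_act 1%g x = x.
Proof.
move: x; apply: (@freeg_ext _ _ (free_act 1%g) idfun) => -[h p].
by rewrite zliftE mulr1z /= mul1g.
Qed.

Fact free_actM g h x : free_act (g * h)%g x = free_act g (free_act h x).
Proof. by rewrite zlift_zlift; apply: zlift_eq => hp /=; rewrite mulgA. Qed.

Definition free_gmodule : gmodule G := GModule free_act1 free_actM.

Fact free_cover_gmapE g (x : free_gmodule) :
  zlift (fun hp : G * P => gact hp.1 hp.2) (gact g x)
  = gact g (zlift (fun hp : G * P => gact hp.1 hp.2) x).
Proof.
rewrite [LHS]zlift_zlift zlift_comp; apply: zlift_eq => hp /=.
by rewrite gactM.
Qed.

Definition free_cover : gmap free_gmodule P := @GMap G free_gmodule P _ free_cover_gmapE.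

Lemma projective_section : projective P ->
  exists iota : gmap P free_gmodule, forall p, free_cover (iota p) = p.
Proof.
move=> /(_ free_gmodule P free_cover (gid P)); apply => p.
by exists << (1%g, p) >>; rewrite [LHS]zliftE mulr1z /= gact1.
Qed.
End FreeCover.

(** A retract of a free module turns additive maps k : C -> C' that need not
    commute with G into maps of tensor products: on the free generator
    g p one transports k by g.  The construction is functorial enough to carry
    an additive contraction of a complex C to one of the complex P (x)_G C. *)
Section Twist.
Variables (G : groupType) (P : gmodule G) (iota : gmap P (free_gmodule P)).
Hypothesis iotaK : forall p, free_cover P (iota p) = p.

Section Def.
Variables (C C' : gmodule G) (k : {additive C -> C'}).

Definition twist_gen (c : C) (hp : G * P) : tensor P C' :=
  tens (gact hp.1 hp.2) (gact hp.1 (k (gact hp.1^-1%g c))).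

Fact twist_subproof x : tensor_rel x ->
  zlift (fun pc : P * C => zlift (twist_gen pc.2) (iota pc.1)) x = 0.
Proof.
case=> [p p' c|p c c'|g p c]; rewrite !raddfB !zliftE !mulr1z ![(_, _).1]/= ![(_, _).2]/=.
- by rewrite (raddfD iota) (raddfD (zlift _)) [_ + _ - _]addrAC addrK subrr.
- apply/eqP; rewrite -addrA -opprD subr_eq0; apply/eqP.
  by rewrite -zliftD; apply: zlift_eq => hp; rewrite /twist_gen !raddfD tensDr.
- apply/eqP; rewrite subr_eq0; apply/eqP.
  rewrite gmapE zlift_zlift; apply: zlift_eq => -[h q]; rewrite /twist_gen /=.
  by rewrite -!gactM invgM -mulgA mulVg mulg1 !gactM tensG.
Qed.

Definition twist : {additive tensor P C -> tensor P C'} := qlift twist_subproof.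

Lemma twistE p c : twist (tens p c) = zlift (twist_gen c) (iota p).
Proof. by rewrite /twist /tens qliftE zliftE mulr1z. Qed.
End Def.

Lemma twist_eq (C C' : gmodule G) (k k' : {additive C -> C'}) :
  k =1 k' -> twist k =1 twist k'.
Proof.
move=> kk'; apply: tensor_ext => p c; rewrite !twistE; apply: zlift_eq => hp.
by rewrite /twist_gen kk'.
Qed.

Lemma twistD (C C' : gmodule G) (k k' : {additive C -> C'}) x :
  twist (k \+ k') x = twist k x + twist k' x.
Proof.
move: x; apply: (@tensor_ext _ _ _ _ _ (twist k \+ twist k')) => p c.
rewrite -[RHS]/(twist k (tens p c) + twist k' (tens p c)) !twistE -zliftD.
by apply: zlift_eq => hp; rewrite /twist_gen raddfD tensDr.
Qed.

Lemma twist_id (C : gmodule G) x : twist (idfun : {additive C -> C}) x = x.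
Proof.
move: x; apply: (@tensor_ext _ _ _ _ _ idfun) => p c; rewrite twistE.
rewrite -[RHS]/(tens p c) -{2}[p]iotaK [in RHS]/= -/(tens _ _).
have tensB : zmod_morphism (fun q : P => tens q c).
  move=> q r; apply/eqP; rewrite eq_sym subr_eq -tensDl; apply/eqP.
  by rewrite subrK.
rewrite -[RHS]/(mk_additive tensB (zlift _ (iota p))) zlift_comp.
apply: zlift_eq => hp.
by rewrite /twist_gen /= -gactM mulgV gact1.
Qed.

Lemma twist_post (C C' C'' : gmodule G) (k : {additive C -> C'}) (f : gmap C' C'') x :
  tensor_map (gid P) f (twist k x) = twist (f \o k) x.
Proof.
move: x; apply: (@tensor_ext _ _ _ _ (tensor_map (gid P) f \o twist k)) => p c.
rewrite -[LHS]/(tensor_map (gid P) f (twist k (tens p c))) !twistE zlift_comp.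
by apply: zlift_eq => hp; rewrite /twist_gen tensor_mapE (gmapE f).
Qed.

Lemma twist_pre (B C C' : gmodule G) (k : {additive C -> C'}) (f : gmap B C) x :
  twist k (tensor_map (gid P) f x) = twist (k \o f) x.
Proof.
move: x; apply: (@tensor_ext _ _ _ _ (twist k \o tensor_map (gid P) f)) => p c.
rewrite -[LHS]/(twist k (tensor_map (gid P) f (tens p c))) tensor_mapE !twistE.
by apply: zlift_eq => hp; rewrite /twist_gen -(gmapE f).
Qed.
End Twist.

(** * Simplicial sets with exact augmented chains *)

Definition augmentation (X : sset) : {additive schain X 0 -> int} := zlift (fun=> 1 : int).

Definition aug_exact (X : sset) :=
  [/\ exists x, augmentation X x = 1,
      forall x, augmentation X x = 0 -> exists y, x = schain_bd X 0 y &
      forall q x, schain_bd X q x = 0 -> exists y, x = schain_bd X q.+1 y].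

Lemma augmentation_bd X x : augmentation X (schain_bd X 0 x) = 0.
Proof.
move: x; apply: (@freeg_ext _ _ (augmentation X \o schain_bd X 0) \0) => x.
rewrite -[LHS]/(augmentation X (schain_bd X 0 << x >>)) -[RHS]/(0 : int).
by rewrite schain_bdE mulr1z big_ord_recl big_ord1 raddfD !zliftE.
Qed.

Lemma augmentation_map (X Y : sset) (f : smap X Y) x :
  augmentation Y (schain_map f 0 x) = augmentation X x.
Proof. by rewrite [LHS]zlift_zlift. Qed.

(** Both sides vanish in positive degrees, and in degree 0 the augmentation tells
    the classes apart. *)
Lemma aug_exact_homology_bij (X Y : sset) (f : smap X Y) n :
  aug_exact X -> aug_exact Y -> bijective (homology_map (chains_map f) n).
Proof.
move=> [[u u1] X0 XS] [_ Y0 YS]; apply: homology_at_map_bij.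
  case: n => [|n] x bx [y yE]; last by have [z ->] := XS n x bx; exists z.
  have [|z ->] := X0 x; last by exists z.
  by rewrite -(augmentation_map f) -[schain_map _ _ _]yE augmentation_bd.
case: n => [|n] y by0.
  exists (u *~ augmentation Y y).
  have [|z zE] := Y0 (y - schain_map f 0 (u *~ augmentation Y y)).
    by rewrite raddfB augmentation_map raddfMz u1 intz subrr.
  by exists z; split => //; rewrite -[bd (chains Y) 0 z]zE addrC subrK.
have [z ->] := YS n y by0.
by exists 0, z; split; rewrite ?raddf0 ?add0r.
Qed.

Section Contraction.
Variable X : sset.
Hypothesis X_exact : aug_exact X.

(** Chains are free, so that a preimage chosen for each simplex extends additively;
    xget gives the junk value 0 when there is no preimage. *)
Definition solve q (r : {additive schain X q -> schain X q}) :
    {additive schain X q -> schain X q.+1} :=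
  zlift (fun x => xget 0 [set y | r << x >> = schain_bd X q y]).

Lemma solveP q (r : {additive schain X q -> schain X q}) :
  (forall x, exists y, r x = schain_bd X q y) ->
  forall x, schain_bd X q (solve r x) = r x.
Proof.
move=> rP; apply: (@freeg_ext _ _ (schain_bd X q \o solve r)) => x.
rewrite -[LHS]/(schain_bd X q (solve r << x >>)) zliftE mulr1z.
by have [y yE] := rP << x >>; case: xgetP => [z _ -> //|/(_ y)].
Qed.

Definition base_chain : schain X 0 := xget 0 [set x | augmentation X x = 1].

Lemma base_chainE : augmentation X base_chain = 1.
Proof.
have [[x x1] _ _] := X_exact.
by rewrite /base_chain; case: xgetP => [z _ -> //|/(_ x)].
Qed.

Fact base_map_additive : zmod_morphism (fun m : int => base_chain *~ m).
Proof. by move=> m n; rewrite mulrzBr. Qed.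
Definition base_map : {additive int -> schain X 0} := mk_additive base_map_additive.

Fixpoint contraction q : {additive schain X q -> schain X q.+1} :=
  match q with
  | 0 => solve (idfun \- (base_map \o augmentation X))
  | q'.+1 => solve (idfun \- (contraction q' \o schain_bd X q'))
  end.

Lemma contraction0 x :
  schain_bd X 0 (contraction 0 x) = x - base_map (augmentation X x).
Proof.
have [_ X0 _] := X_exact.
rewrite [LHS]solveP // => {}x; apply: X0.
rewrite -[LHS]/(augmentation X (x - base_chain *~ augmentation X x)).
by rewrite raddfB raddfMz base_chainE intz subrr.
Qed.

Lemma contractionS q x :
  schain_bd X q.+1 (contraction q.+1 x) = x - contraction q (schain_bd X q x).
Proof.
have [_ _ XS] := X_exact.
elim: q x => [|q IH] x; rewrite [LHS]solveP // => {}x; apply: XS.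
  rewrite -[LHS]/(schain_bd X 0 (x - contraction 0 (schain_bd X 0 x))).
  by rewrite raddfB contraction0 augmentation_bd (raddf0 base_map) subr0 subrr.
rewrite -[LHS]/(schain_bd X q.+1 (x - contraction q.+1 (schain_bd X q.+1 x))).
by rewrite raddfB IH schain_bd_bd (raddf0 (contraction q)) subr0 subrr.
Qed.
End Contraction.

Section EquivariantAugmentation.
Variables (G : groupType) (P : projective_resolution G) (X : gsset G).
Hypothesis X_exact : aug_exact X.

Lemma columns_contractible : exists
  (eta : forall p, {additive tensor (P p) (Ztriv G) -> tensor (P p) (gchains X 0)})
  (K : forall p q, {additive tensor (P p) (gchains X q) -> tensor (P p) (gchains X q.+1)}),
  [/\ forall p b, tensor_map (gid (P p)) (chain_aug X) (eta p b) = b,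
      forall p x, tensor_map (gid (P p)) (gbd (gchains X) 0) (K p 0 x)
        + eta p (tensor_map (gid (P p)) (chain_aug X) x) = x &
      forall p q x, tensor_map (gid (P p)) (gbd (gchains X) q.+1) (K p q.+1 x)
        + K p q (tensor_map (gid (P p)) (gbd (gchains X) q) x) = x].
Proof.
have sec p := projective_section (@res_projective G P p).
pose iota p := projT1 (cid (sec p)); have iotaK p := projT2 (cid (sec p)).
exists (fun p => @twist G (P p) (iota p) (Ztriv G) (gchains X 0) (base_map X)).
exists (fun p q => @twist G (P p) (iota p) (gchains X q) (gchains X q.+1) (contraction X q)).
split=> [p b|p x|p q x]; rewrite twist_post ?twist_pre -?twistD -[RHS](twist_id (iotaK p));
  apply: twist_eq => y /=.
- by rewrite -[LHS]/(augmentation X (_ *~ _)) raddfMz base_chainE // intz.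
- by rewrite -[schain_bd X 0 _ + _]/(schain_bd X 0 (contraction X 0 y) + _)
    contraction0 // subrK.
- by rewrite -[schain_bd X _ _ + _]/(schain_bd X _ (contraction X q.+1 y) + _)
    contractionS // subrK.
Qed.

Lemma eqv_homology_aug_bij n : bijective (eqv_homology_aug P X n).
Proof.
have [eta [K [etaK K0 KS]]] := columns_contractible.
exact: (@columnwise_homology_bij G P (gchains X) (chain_aug X) (@chain_aug_bd G X)
  eta K etaK K0 KS n).
Qed.

Lemma eqv_cohomology_aug_bij A n : bijective (eqv_cohomology_aug P A X n).
Proof.
have [eta [K [etaK K0 KS]]] := columns_contractible.
exact: (@columnwise_cohomology_bij G P (gchains X) (chain_aug X) (@chain_aug_bd G X)
  eta K etaK K0 KS A n).
Qed.
End EquivariantAugmentation.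

(** The augmentations of X and of Y are isomorphisms on homology and cohomology and
    are compatible with f; hence f is an isomorphism as well. *)
Section EquivariantMap.
Variables (G : groupType) (P : projective_resolution G) (X Y : gsset G) (f : gsmap X Y).
Hypotheses (X_exact : aug_exact X) (Y_exact : aug_exact Y).

Lemma total_aug_map n x :
  total_aug P (@chain_aug_bd G Y) n (total_map P (gchains_map f) n x) =
  total_aug P (@chain_aug_bd G X) n x.
Proof.
rewrite -[LHS]/(tensor_map (gid (P n)) (chain_aug Y)
  (tensor_map (gid (P n)) (gchains_map f 0) (x (corner n)))).
rewrite -[RHS]/(tensor_map (gid (P n)) (chain_aug X) (x (corner n))).
move: (x (corner n)); apply: (@tensor_ext _ _ _ _ (tensor_map (gid (P n)) (chain_aug Y) \o
  tensor_map (gid (P n)) (gchains_map f 0))) => p c.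
rewrite -[LHS]/(tensor_map (gid (P n)) (chain_aug Y)
  (tensor_map (gid (P n)) (gchains_map f 0) (tens p c))).
rewrite !tensor_mapE; congr (tens _ _); exact: augmentation_map.
Qed.

Lemma eqv_homology_map_bij n : bijective (eqv_homology_map P f n).
Proof.
have [g gK Kg] := eqv_homology_aug_bij P Y_exact n.
apply: (eq_bij (bij_comp (Bijective Kg gK) (eqv_homology_aug_bij P X_exact n))) => q.
apply: (canLR gK); exact: (esym (homology_map_comp total_aug_map q)).
Qed.

Lemma eqv_cohomology_map_bij A n : bijective (eqv_cohomology_map P A f n).
Proof.
have [g gK Kg] := eqv_cohomology_aug_bij P Y_exact A n.
apply: (eq_bij (bij_comp (eqv_cohomology_aug_bij P X_exact A n) (Bijective Kg gK))) => q.
rewrite -[q in RHS]Kg; exact: (esym (cohomology_map_comp total_aug_map (g q))).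
Qed.
End EquivariantMap.

(** * Acyclicity when finitely many vertices have a common neighbour *)

Lemma freeg_ext_dom (K : choiceType) (A : zmodType) (f g : {additive {freeg K} -> A}) D :
  (forall x, x \in dom D -> f << x >> = g << x >>) -> f D = g D.
Proof.
move=> fg; rewrite -[D]freeg_sumE !raddf_sum; apply: eq_big_seq => x xD.
by rewrite -[coeff x D]intz -freegU_mulz !raddfMz fg.
Qed.

Section Cone.
Variable Gam : graph.

(** Equality is allowed, as in the flag complex; this also covers the zero module,
    whose single Lagrangian has no neighbour. *)
Definition adj (x y : Gam) := x = y \/ edge x y.

Lemma adj_sym x y : adj x y -> adj y x.
Proof. by case=> [->|/edge_sym]; [left|right]. Qed.

Definition coned (z : Gam) k (x : Fl Gam k) := forall i, adj (val x i) z.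

Definition cone_fun (z : Gam) k (x : Fl Gam k) (i : 'I_k.+2) : Gam :=
  if unlift ord0 i is Some j then val x j else z.

Fact cone_subproof z k (x : Fl Gam k) : coned z x -> cone_fun z x \in @flag Gam k.+1.
Proof.
move=> xz; rewrite inE => mu nu; rewrite /cone_fun.
case: unliftP => [i ->|->]; case: unliftP => [j ->|->] //.
  by rewrite ltnS; exact: (set_valP x).
by move=> _; exact: adj_sym.
Qed.

Definition cone z k (x : Fl Gam k) (xz : coned z x) : Fl Gam k.+1 :=
  exist _ (cone_fun z x) (cone_subproof xz).

Fact vertex_subproof (z : Gam) : (fun=> z) \in @flag Gam 0.
Proof. by rewrite inE => mu nu _; left. Qed.
Definition vertex_simplex z : Fl Gam 0 := exist _ (fun=> z) (vertex_subproof z).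

Lemma coned_sop z m n (f : {omorphism 'I_m.+1 -> 'I_n.+1}) (x : Fl Gam n) :
  coned z x -> coned z (sop f x).
Proof. by move=> xz i; exact: xz. Qed.

Lemma face0_cone z k (x : Fl Gam k) (xz : coned z x) :
  sop (@face k ord0) (cone xz) = x.
Proof.
apply: val_inj; apply: functional_extensionality_dep => i.
by rewrite /= /cone_fun /face liftK.
Qed.

Lemma faceS_cone z k (x : Fl Gam k.+1) (xz : coned z x) (i : 'I_k.+2) :
  sop (@face k.+1 (fintype.lift ord0 i)) (cone xz) = cone (coned_sop (@face k i) xz).
Proof.
apply: val_inj; apply: functional_extensionality_dep => j.
rewrite /= /cone_fun /face; case: (unliftP ord0 j) => [j' ->|->].
  have -> : fintype.lift (fintype.lift ord0 i) (fintype.lift ord0 j') =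
      fintype.lift ord0 (fintype.lift i j').
    by apply: val_inj; rewrite /= /bump /= !add1n ltnS addnS.
  by rewrite liftK.
have -> : fintype.lift (fintype.lift ord0 i) ord0 = ord0 by apply: val_inj.
by rewrite unlift_none.
Qed.

Lemma face1_cone z (x : Fl Gam 0) (xz : coned z x) :
  sop (@face 0 (fintype.lift ord0 ord0)) (cone xz) = vertex_simplex z.
Proof.
apply: val_inj; apply: functional_extensionality_dep => j.
rewrite /= /cone_fun (ord1 j) (_ : face _ _ = ord0) ?unlift_none //.
exact: val_inj.
Qed.

(** Simplices that cannot be coned off from z are sent to 0, which makes the
    operator total; it is only used on chains whose simplices can. *)
Definition cone_chain z k : {additive schain (Fl Gam) k -> schain (Fl Gam) k.+1} :=
  zlift (fun x => if pselect (coned z x) is left xz then << cone xz >> else 0).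

Lemma cone_chainE z k (x : Fl Gam k) (xz : coned z x) :
  cone_chain z k << x >> = << cone xz >>.
Proof.
rewrite [LHS]zliftE mulr1z; case: pselect => // xz'.
by rewrite (Prop_irrelevance xz xz').
Qed.

Lemma cone_chain_bd0 z (c : schain (Fl Gam) 0) : (forall x, x \in dom c -> coned z x) ->
  schain_bd _ 0 (cone_chain z 0 c) = c - << vertex_simplex z >> *~ augmentation (Fl Gam) c.
Proof.
move=> cz; have vB : zmod_morphism (fun a : schain (Fl Gam) 0 =>
    << vertex_simplex z >> *~ augmentation (Fl Gam) a : schain (Fl Gam) 0).
  by move=> a b; rewrite raddfB mulrzBr.
rewrite -[RHS]/((idfun \- mk_additive vB) c).
apply: (@freeg_ext_dom _ _ (schain_bd _ 0 \o cone_chain z 0) (idfun \- mk_additive vB)) => x /cz xz.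
rewrite -[LHS]/(schain_bd _ 0 (cone_chain z 0 << x >>)) cone_chainE.
rewrite -[RHS]/(_ - _ *~ augmentation (Fl Gam) << x >>) [in RHS]zliftE.
rewrite schain_bdE mulr1z big_ord_recl big_ord1 face0_cone face1_cone /=.
by rewrite expr0 expr1 -freegUN.
Qed.

Lemma cone_chain_bdS z k (c : schain (Fl Gam) k.+1) : (forall x, x \in dom c -> coned z x) ->
  schain_bd _ k.+1 (cone_chain z k.+1 c) = c - cone_chain z k (schain_bd _ k c).
Proof.
move=> cz; apply: (@freeg_ext_dom _ _ (schain_bd _ k.+1 \o cone_chain z k.+1)
  (idfun \- (cone_chain z k \o schain_bd _ k))) => x /cz xz.
rewrite -[LHS]/(schain_bd _ k.+1 (cone_chain z k.+1 << x >>)) cone_chainE.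
rewrite -[RHS]/(_ - cone_chain z k (schain_bd _ k << x >>)).
rewrite !schain_bdE !mulr1z big_ord_recl face0_cone expr0; congr (_ + _).
rewrite raddf_sum -sumrN; apply: eq_bigr => i _.
rewrite faceS_cone -[in RHS](intz ((-1) ^+ i)) -freegU_mulz raddfMz.
by rewrite (cone_chainE (coned_sop (@face k i) xz)) freegU_mulz intz freegUN
  exprS mulN1r.
Qed.

(** A chain involves finitely many vertices, so that it can be coned off. *)
Hypothesis common_neighbour : forall l : seq Gam, exists z, forall x, x \in l -> adj x z.

Lemma common_apex k (c : schain (Fl Gam) k) :
  exists z, forall x, x \in dom c -> coned z x.
Proof.
have [z zP] := common_neighbour
  (flatten [seq [seq val x i | i <- enum 'I_k.+1] | x : Fl Gam k <- dom c]).
exists z => x xc i; apply: zP; apply/flatten_mapP; exists x => //.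
by apply: map_f; rewrite mem_enum.
Qed.

Lemma Fl_aug_exact : aug_exact (Fl Gam).
Proof.
split=> [|c c0|k c bc].
- have [z _] := common_neighbour [::].
  by exists << vertex_simplex z >>; rewrite [LHS]zliftE.
- have [z cz] := common_apex c; exists (cone_chain z 0 c).
  by rewrite cone_chain_bd0 // c0 subr0.
- have [z cz] := common_apex c; exists (cone_chain z k.+1 c).
  by rewrite cone_chain_bdS // bc raddf0 subr0.
Qed.
End Cone.

Lemma point_aug_exact : aug_exact (Fl point_graph).
Proof. by apply: Fl_aug_exact => l; exists tt => -[] _; left. Qed.

Lemma common_neighbour_acyclic (Gam : graph) :
  (forall l : seq Gam, exists z, forall x, x \in l -> adj x z) -> acyclic (Fl Gam).
Proof.
move=> GamP n; exists (homology_map (chains_map (Fl_map (const_graph_map Gam))) n).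
exact: aug_exact_homology_bij (Fl_aug_exact GamP) point_aug_exact.
Qed.

(** * A Lagrangian opposite to finitely many given ones *)

Section Pivots.
Variables (D : unitRingType) (M : vectType D^c).
Hypothesis D_division : forall a : D, a != 0 -> a \is a GRing.unit.

Definition coordinate (v : M) (i : 'I_(dim M)) : D := v2r v 0 i.

Lemma coordinateB u v i : coordinate (u - v) i = coordinate u i - coordinate v i.
Proof. by rewrite /coordinate linearB !mxE. Qed.

Lemma coordinateZ u a i : coordinate (u *>: a) i = coordinate u i * a.
Proof. by rewrite /coordinate /rscale linearZ !mxE. Qed.

Lemma coordinate_eq0 u : (forall i, coordinate u i = 0) -> u = 0.
Proof.
move=> u0; apply: (can_inj v2rK); rewrite linear0; apply/rowP => i.
by rewrite mxE; exact: u0.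
Qed.

Definition leads (v : M) i :=
  coordinate v i != 0 /\ forall j : 'I_(dim M), (j < i)%N -> coordinate v j = 0.

(** The number of pivots is the dimension of N.  Pivots give at once what is needed
    of dimensions over a division ring: strict monotonicity and a bound. *)
Definition pivots (N : set M) : {set 'I_(dim M)} :=
  [set i | `[< exists2 v, N v & leads v i >]]%SET.

Lemma submoduleB (N : set M) u v : submodule N -> N u -> N v -> N (u - v).
Proof.
move=> [_ ND NZ] Nu Nv; apply: ND => //.
by rewrite -scaleN1r; exact: (NZ v (- 1)).
Qed.

(** Gaussian elimination: if N' has the pivots of N, every vector of N is cleared
    by vectors of N' from its leading coordinate on. *)
Lemma pivots_proper (N N' : set M) : submodule N -> submodule N' ->
  N' `<=` N -> ~ N `<=` N' -> (#|pivots N'| < #|pivots N|)%N.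
Proof.
move=> subN subN' N'N nNN'; apply: proper_card; rewrite finset.properEneq.
apply/andP; split; last first.
  apply/fintype.subsetP => i; rewrite !finset.in_set => /asboolP[v N'v vi].
  by apply/asboolP; exists v; [exact: N'N|exact: vi].
apply/eqP => pivE; apply: nNN'.
suff main k v : (k <= dim M)%N -> N v ->
    (forall j : 'I_(dim M), (j < dim M - k)%N -> coordinate v j = 0) -> N' v.
  by move=> v Nv; apply: (main (dim M)) => // j; rewrite subnn.
elim: k v => [|k IH] v kM Nv v0.
  rewrite (_ : v = 0); first by case: subN'.
  by apply: coordinate_eq0 => i; apply: v0; rewrite subn0.
have iM : (dim M - k.+1 < dim M)%N by rewrite ltn_subrL (leq_trans _ kM).
pose i := Ordinal iM.
have ltS (j : 'I_(dim M)) : (j < dim M - k)%N -> (j < dim M - k.+1)%N \/ j = i.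
  move=> jk; have [|ij] := ltnP j (dim M - k.+1); [by left|right].
  by apply: val_inj; apply/eqP; rewrite eqn_leq ij andbT -ltnS subnSK.
have [vi0|vi] := eqVneq (coordinate v i) 0.
  by apply: IH => // [|j /ltS[/v0 //|->//]]; exact: ltnW.
have : i \in pivots N' by rewrite pivE finset.in_set; apply/asboolP; exists v.
rewrite finset.in_set => /asboolP[w N'w [wi w0]].
set a := (coordinate w i)^-1 * coordinate v i.
have [_ N'D N'Z] := subN'.
have vE : v = (v - w *>: a) + w *>: a by rewrite subrK.
rewrite vE; apply: N'D; last exact: N'Z.
apply: IH; first exact: ltnW.
  by apply: submoduleB => //; apply: N'N; exact: N'Z.
move=> j; rewrite coordinateB coordinateZ => /ltS[ji|->].
  by rewrite v0 // w0 // mul0r subr0.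
by rewrite /a mulrA mulrV ?mul1r ?subrr //; exact: D_division.
Qed.
End Pivots.

Section Opposite.
Variables (D : unitRingType) (J : involution D) (eps : D).
Hypothesis D_division : forall a : D, a != 0 -> a \is a GRing.unit.
Hypothesis eps_sign : eps = 1 \/ eps = -1.
Variables (M : vectType D^c) (h : hermitian_form J (- eps) M).

Lemma rscale1 (v : M) : v *>: 1 = v. Proof. exact: scale1r. Qed.
Lemma rscaleA (v : M) a b : v *>: a *>: b = v *>: (a * b).
Proof. by rewrite /rscale scalerA. Qed.
Lemma rscaleDr (v : M) a b : v *>: (a + b) = v *>: a + v *>: b.
Proof. exact: scalerDl. Qed.
Lemma rscaleNr (v : M) a : v *>: (- a) = - (v *>: a).
Proof. exact: scaleNr. Qed.
Lemma rscaleBr (v : M) a b : v *>: (a - b) = v *>: a - v *>: b.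
Proof. exact: scalerBl. Qed.
Lemma rscaleBl (u v : M) a : (u - v) *>: a = u *>: a - v *>: a.
Proof. exact: scalerBr. Qed.
Lemma rscale0r (v : M) : v *>: 0 = 0. Proof. exact: scale0r. Qed.

Fact hform_zmod_morphism u : zmod_morphism (h u).
Proof.
by move=> v w; apply/eqP; rewrite eq_sym subr_eq -hformDr subrK.
Qed.
Lemma hformB u v w : h u (v - w) = h u v - h u w.
Proof. exact: hform_zmod_morphism. Qed.
Lemma hformBl u v w : h (u - v) w = h u w - h v w.
Proof. by apply/eqP; rewrite eq_sym subr_eq -hformDl subrK. Qed.
Lemma hform0 u : h u 0 = 0.
Proof. exact: (raddf0 (mk_additive (hform_zmod_morphism u))). Qed.
Lemma hformZr u v b : h u (v *>: b) = h u v * b.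
Proof. by rewrite -{1}[u]rscale1 hformZ Defs.inv1 mul1r. Qed.
Lemma hformZl u v a : h (u *>: a) v = J a * h u v.
Proof. by rewrite -{1}[v]rscale1 hformZ mulr1. Qed.

Lemma eps_comm a : eps * a = a * eps.
Proof. by case: eps_sign => ->; rewrite ?mul1r ?mulr1 // mulN1r mulrN1. Qed.

Lemma eps_sqr : eps * eps = 1.
Proof. by case: eps_sign => ->; rewrite ?mul1r // mulrNN mulr1. Qed.

Definition transvection (z : M) (a : D) (v : M) := v - z *>: (a * h z v).

Lemma transvection_linear z a : linear (transvection z a).
Proof.
move=> b u v; rewrite /transvection hformDr -[b *: u]/(u *>: b) hformZr.
by rewrite mulrDr rscaleDr opprD addrACA mulrA -rscaleA -rscaleBl.
Qed.

Lemma transvectionK z a : h z z = 0 -> cancel (transvection z a) (transvection z (- a)).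
Proof.
move=> zz v; rewrite {1}/transvection hformB hformZr zz mul0r subr0.
by rewrite mulNr rscaleNr opprK subrK.
Qed.

(** For isotropic z the two sides differ, up to sign, by
    h(z, u)^J (a - a^J eps) h(z, v); this is the reason for D^eps to enter. *)
Lemma transvection_form z a u v : h z z = 0 -> a - J a * eps = 0 ->
  h (transvection z a u) (transvection z a v) = h u v.
Proof.
move=> zz /eqP; rewrite subr_eq0 => /eqP aE.
have Ja : J a = a * eps by rewrite [a in RHS]aE -mulrA eps_sqr mulr1.
rewrite /transvection hformB !hformBl !hformZr !hformZl zz mulr0 mul0r subr0.
rewrite [h u z]hformJ Defs.invM Ja -addrA -opprD -!mulrA -mulrDr mulNr.
by rewrite [a * _]mulrA -eps_comm -mulrA addrN mulr0 subr0.
Qed.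

Definition transvection_isometry z a (zz : h z z = 0) (aE : a - J a * eps = 0) : Defs.isometry h.
Proof.
refine (@Isometry D J (- eps) M h (transvection z a) (transvection z (- a))
  (transvectionK a zz) _ (transvection_linear z a) (fun u v => transvection_form u v zz aE)).
by rewrite -{2}[a]opprK; exact: transvectionK.
Defined.

Lemma lagrangian_form0 X u v : lagrangian h X -> X u -> X v -> h u v = 0.
Proof. by move=> [_ XP] Xu; rewrite XP; apply. Qed.

(** Scale y so that h(z, y) = 1; then y - z a lies in X, and likewise y' - z a'.  If
    a and a' differ, some t in Y orthogonal to z has t - z in X, and y - t a is a
    nonzero vector in both X and Y. *)
Lemma transvection_bad_unique X Y z a a' y y' : submodule X -> submodule Y ->
  (forall v, X v -> Y v -> v = 0) ->
  Y y -> X (transvection z a y) -> transvection z a y != 0 ->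
  Y y' -> X (transvection z a' y') -> transvection z a' y' != 0 -> a = a'.
Proof.
move=> subX subY XY.
have [_ XD XZ] := subX; have [_ YD YZ] := subY.
have normalize b w : Y w -> X (transvection z b w) -> transvection z b w != 0 ->
    exists2 w', Y w' & h z w' = 1 /\ X (w' - z *>: b).
  move=> Yw Xw nw; have [c0|c] := eqVneq (h z w) 0.
    move: Xw nw; rewrite /transvection c0 mulr0 rscale0r subr0 => Xw.
    by rewrite (XY w) ?eqxx.
  exists (w *>: (h z w)^-1); first exact: YZ.
  rewrite hformZr mulrV; last exact: D_division.
  split => //; have := XZ _ (h z w)^-1 Xw.
  by rewrite rscaleBl rscaleA -mulrA mulrV ?mulr1 //; exact: D_division.
move=> Yy Xy ny Yy' Xy' ny'; apply/eqP; apply: contraT => naa'.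
have [w Yw [zw Xw]] := normalize _ _ Yy Xy ny.
have [w' Yw' [zw' Xw']] := normalize _ _ Yy' Xy' ny'.
have ud : a - a' \is a GRing.unit by apply: D_division; rewrite subr_eq0.
pose t := (w - w') *>: (a - a')^-1.
have Yt : Y t by apply: YZ; exact: submoduleB.
have zt : h z t = 0 by rewrite hformZr hformB zw zw' subrr mul0r.
have Xt : X (t - z).
  have -> : t - z = ((w - z *>: a) - (w' - z *>: a')) *>: (a - a')^-1.
    have -> : w - z *>: a - (w' - z *>: a') = (w - w') - z *>: (a - a').
      by rewrite rscaleBr !opprB addrACA [RHS]addrACA [in LHS](addrC (- _)).
    by rewrite rscaleBl rscaleA mulrV // rscale1.
  by apply: XZ; exact: submoduleB.
have wt : w - t *>: a = 0.
  apply: XY; last by apply: submoduleB => //; exact: YZ.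
  have -> : w - t *>: a = (w - z *>: a) - (t - z) *>: a.
    by rewrite rscaleBl opprB addrA subrK.
  by apply: submoduleB => //; exact: XZ.
have := congr1 (h z) wt.
by rewrite hformB hformZr zw zt mul0r subr0 hform0 => /eqP; rewrite oner_eq0.
Qed.

Hypothesis Deps_infinite : infinite_set [set a : D | a - J a * eps = 0].
Hypothesis M_hyperbolic : hyperbolic h.

Lemma dual_separates (X : vectType D^c) (x : X) : x != 0 ->
  exists xi : right_dual X J, val xi x != 0.
Proof.
move=> x0; have [i xi] : exists i, coordinate x i != 0.
  apply: contrapT => /forallNP x'; case/eqP: x0; apply: coordinate_eq0 => i.
  by apply/eqP; have /negP := x' i; rewrite negbK.
have cdual : dual_pred (fun v : X => coordinate v i).
  apply/asboolP; split=> [u v|v a]; last exact: coordinateZ.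
  by rewrite /coordinate linearD mxE.
by exists (Sub _ cdual).
Qed.

Lemma exists_lagrangian : exists Y, lagrangian h Y.
Proof.
have [X [phi [[psi phiK psiK] hE]]] := M_hyperbolic.
exists [set v | (phi v).2 = 0]; split.
  split=> [|u v /= u0 v0|u a /= u0]; first by rewrite /= linear0.
    by rewrite linearD /= u0 v0 addr0.
  by rewrite /rscale linearZ /= u0 scaler0.
apply/seteqP; split=> [v v0 u u0|v vP] /=.
  by rewrite hE /hyperbolic_form u0 v0 /= Defs.inv0 mul0r addr0.
apply: contrapT => /eqP v2; suff : val (phi v).2 =1 (fun=> 0).
  move=> v20; case/eqP: v2; apply: val_inj; exact: functional_extensionality_dep.
move=> x; have := vP (psi (x, 0)); rewrite /= psiK => /(_ erefl).
rewrite hE /hyperbolic_form psiK /= add0r => /(congr1 (fun a => a * eps)).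
rewrite mulrN mulNr -mulrA eps_sqr mulr1 mul0r => /eqP; rewrite oppr_eq0 => /eqP J0.
by rewrite -[LHS](Defs.invK J) J0 Defs.inv0.
Qed.

Lemma exists_isotropic u : u != 0 -> exists2 z, h z z = 0 & h z u = 1.
Proof.
move=> u0.
suff [z zz zu] : exists2 z, h z z = 0 & h z u != 0.
  exists (z *>: J (h z u)^-1); first by rewrite hformZ zz mulr0 mul0r.
  by rewrite hformZl Defs.invK mulVr //; exact: D_division.
have [X [phi [[psi phiK psiK] hE]]] := M_hyperbolic.
have [x2|x2] := eqVneq (phi u).2 0.
  have x1 : (phi u).1 != 0.
    apply: contraNneq u0 => x1; apply/eqP; apply: (can_inj phiK).
    by rewrite linear0 [phi u]surjective_pairing x1 x2.
  have [xi xix] := dual_separates x1.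
  exists (psi (0, xi)); rewrite hE psiK /hyperbolic_form /=.
    have [xiD _] := asboolW (valP xi).
    have -> : val xi 0 = 0 by apply: (addrI (val xi 0)); rewrite -xiD !addr0.
    by rewrite Defs.inv0 mul0r addr0.
  have [xiD _] := asboolW (valP (phi u).2).
  by rewrite x2 /= Defs.inv0 mul0r addr0.
have [x xx] : exists x, val (phi u).2 x != 0.
  apply: contrapT => /forallNP x'; case/eqP: x2; apply: val_inj.
  apply: functional_extensionality_dep => x.
  by apply/eqP; have /negP := x' x; rewrite negbK.
exists (psi (x, 0)); rewrite hE psiK /hyperbolic_form /= add0r ?Defs.inv0 ?mul0r //.
apply: contra xx => /eqP/(congr1 (fun a => a * eps)).
rewrite mulrN mulNr -mulrA eps_sqr mulr1 mul0r => /eqP; rewrite oppr_eq0 => /eqP J0.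
by rewrite -[X in X == _](Defs.invK J) J0 Defs.inv0.
Qed.

Lemma transvection_lagrangian z a Y (zz : h z z = 0) (aE : a - J a * eps = 0) :
  lagrangian h Y -> lagrangian h (transvection z a @` Y).
Proof.
move=> LY; have := iso_lagrangian (transvection_isometry zz aE) (exist _ Y (mem_set LY)).
by rewrite inE.
Qed.

(** Each opposition to be kept excludes at most one a, and the intersection with X
    shrinks for every a <> 0; an infinite D^eps contains an a that is good for all. *)
Lemma opposite_improve (l : seq (set M)) X Y : lagrangian h X -> lagrangian h Y ->
  (forall Z, Z \in l -> submodule Z /\ forall v, Z v -> Y v -> v = 0) ->
  (exists2 u, u != 0 & X u /\ Y u) ->
  exists Y', [/\ lagrangian h Y', forall Z, Z \in l -> forall v, Z v -> Y' v -> v = 0,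
    X `&` Y' `<=` X `&` Y & ~ X `&` Y `<=` X `&` Y'].
Proof.
move=> LX LY lY [u u0 [Xu Yu]]; have [z zz zu] := exists_isotropic u0.
pose bad Z := [set a | exists y, [/\ Y y, Z (transvection z a y) & transvection z a y != 0]].
have [a [aE [a0 agood]]] : exists a, a - J a * eps = 0 /\
    (a != 0 /\ forall Z, Z \in l -> ~ bad Z a).
  have fin : finite_set ([set 0] `|` \bigcup_(Z in [set` l]) bad Z).
    rewrite finite_setU; split; first exact: finite_set1.
    apply: bigcup_finite; first exact: finite_seq.
    move=> Z /lY[subZ YZ].
    have [[a Za]|/forallNP nZ] := pselect (exists a, bad Z a); last first.
      by rewrite (_ : bad Z = set0) //; apply/seteqP; split=> // b /nZ.
    apply: (sub_finite_set (B := [set a])) => // b [y [Yy Zy ny]].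
    have [y' [Yy' Zy' ny']] := Za.
    by have [subY _] := LY; rewrite (transvection_bad_unique subZ subY YZ Yy Zy ny Yy' Zy' ny').
  have /infinite_setN0[a [aE nfin]] := infinite_setD Deps_infinite fin.
  exists a; split => //; split.
    by apply/eqP => a0; apply: nfin; left.
  by move=> Z Zl Za; apply: nfin; right; exists Z.
(* u is orthogonal to X and to Y but not to z, so that the image of a vector y of Y
   can lie in X only if y is fixed. *)
have key y : Y y -> X (transvection z a y) -> h z y = 0.
  move=> Yy Xy; have := lagrangian_form0 LX Xu Xy.
  rewrite /transvection hformB (lagrangian_form0 LY Yu Yy) sub0r hformZr.
  rewrite hformJ zu Defs.inv1 mul1r mulNr opprK => /(congr1 (fun b => a^-1 * (eps * b))).
  rewrite [eps * (eps * _)]mulrA eps_sqr mul1r !mulr0 mulrA mulVr ?mul1r //.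
  exact: D_division.
exists (transvection z a @` Y); split.
- exact: transvection_lagrangian.
- move=> Z Zl _ /[swap] -[y Yy <-] Zy; apply/eqP; apply: contraT => ny.
  by case: (agood _ Zl); exists y.
- move=> _ [/[swap] -[y Yy <-] Xy].
  move: (Xy); rewrite /transvection (key _ Yy Xy) mulr0 rscale0r subr0.
  by split.
- move=> sub; have [_ [y Yy yu]] := sub u (conj Xu Yu).
  have zy : h z y = 0 by apply: key => //; rewrite yu.
  move: yu; rewrite /transvection zy mulr0 rscale0r subr0 => yu.
  by move: zu; rewrite -yu zy => /esym/eqP; rewrite oner_eq0.
Qed.

Lemma submoduleI (X Y : set M) : submodule X -> submodule Y -> submodule (X `&` Y).
Proof.
move=> [X0 XD XZ] [Y0 YD YZ]; split=> // [u v [Xu Yu] [Xv Yv]|u a [Xu Yu]].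
  by split; [exact: XD|exact: YD].
by split; [exact: XZ|exact: YZ].
Qed.

(** Induction on the list, and for a new X on the dimension of its intersection
    with the Lagrangian found so far. *)
Lemma common_opposite (l : seq (set M)) : (forall X, X \in l -> lagrangian h X) ->
  exists2 Y, lagrangian h Y & forall X, X \in l -> forall v, X v -> Y v -> v = 0.
Proof.
elim: l => [|X l IH] lL.
  by have [Y LY] := exists_lagrangian; exists Y.
have LX : lagrangian h X by apply: lL; rewrite mem_head.
have {}lL Z : Z \in l -> lagrangian h Z by move=> Zl; apply: lL; rewrite inE Zl orbT.
have [Y LY lY] := IH lL.
have [n] := ubnP #|pivots (X `&` Y)|; elim: n Y LY lY => // n IHn Y LY lY pn.
have [XY|nXY] := pselect (forall v, X v -> Y v -> v = 0).
  by exists Y => // Z; rewrite inE => /predU1P[->|/lY].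
have lZ Z : Z \in l -> submodule Z /\ forall v, Z v -> Y v -> v = 0.
  by move=> Zl; split; [have [] := lL _ Zl|exact: lY].
have [u u0 XYu] : exists2 u, u != 0 & X u /\ Y u.
  apply: contrapT => nu; apply: nXY => v Xv Yv; apply/eqP; apply: contraT => v0.
  by case: nu; exists v.
have [Y' [LY' lY' sub nsub]] := opposite_improve LX LY lZ (ex_intro2 _ _ u u0 XYu).
apply: (IHn Y') => //; rewrite ltnS in pn; apply: leq_trans pn.
have [subX _] := LX; have [subY _] := LY; have [subY' _] := LY'.
by apply: pivots_proper => //; exact: submoduleI.
Qed.

Lemma opposition_common_neighbour (l : seq (opposition_graph h)) :
  exists Z : opposition_graph h, forall X, X \in l -> X = Z \/ edge X Z.
Proof.
have [|Y LY lY] := common_opposite (l := [seq val X | X <- l]).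
  by move=> _ /mapP[X _ ->]; exact: (set_valP X).
exists (exist _ Y (mem_set LY)) => X Xl.
have [->|nXY] := eqVneq X (exist _ Y (mem_set LY)); [by left|right].
split; first by apply: contra nXY => /eqP XY; apply/eqP; exact: val_inj.
apply/seteqP; split=> [v [Xv Yv]|_ ->].
  by apply: (lY (val X)) => //; exact: map_f.
have [[X0 _ _] _] := set_valP X; have [[Y0 _ _] _] := LY.
by split.
Qed.
End Opposite.

(** * Contractibility of the geometric realization *)

Section Apex.
Variable Gam : graph.
Hypothesis common_neighbour : forall l : seq Gam, exists z, forall x, x \in l -> adj x z.

(** The vertices v(S) play the part of the barycentres of a subdivision: each is
    chosen after those of the proper subsets of S, adjacent to all of them. *)
Lemma exists_apex : exists v : {fset Gam} -> Gam,
  (forall (S : {fset Gam}) x, x \in S -> adj x (v S)) /\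
  (forall S T : {fset Gam}, (T `<=` S)%fset -> adj (v T) (v S)).
Proof.
have [c cP] := choice common_neighbour.
pose smaller (S : {fset Gam}) := [seq T <- enum_fset (fpowerset S) | #|` T| < #|` S| ]%N.
(* Recursion on a bound n for the size of S; the value does not depend on n. *)
pose fix vn n (S : {fset Gam}) {struct n} : Gam :=
  if n is n'.+1 then c (enum_fset S ++ [seq vn n' T | T <- smaller S]) else c (enum_fset S).
have stepn n (S : {fset Gam}) : (#|` S| <= n)%N -> vn n.+1 S = vn n S.
  elim: n S => [|n IH] S Sn; rewrite [LHS]/=.
    rewrite (_ : smaller S = [::]) /= ?cats0 //.
    rewrite /smaller (@eq_filter _ _ pred0) ?filter_pred0 // => T.
    by move: Sn; rewrite leqn0 => /eqP ->.
  rewrite [RHS]/=; congr (c (_ ++ _)); apply/eq_in_map => T.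
  rewrite mem_filter => /andP[TS _]; apply: IH.
  by rewrite -ltnS (leq_trans TS).
have stable n (S : {fset Gam}) : (#|` S| <= n)%N -> vn n S = vn #|` S| S.
  elim: n => [|n IH]; first by rewrite leqn0 => /eqP ->.
  by rewrite leq_eqVlt => /predU1P[->//|]; rewrite ltnS => Sn; rewrite stepn // IH.
exists (fun S => vn #|` S| S); split=> [S x xS|S T TS].
  case: #|` S| => [|n]; apply: cP => //.
  by rewrite mem_cat; apply/orP; left.
have [->|nTS] := eqVneq T S; first by left.
have : (#|` T| < #|` S|)%N by rewrite fproper_ltn_card // fproperEneq nTS.
case E : #|` S| => [//|n] Tn; apply: cP; rewrite mem_cat; apply/orP; right.
rewrite -(stable n) //; apply: map_f.
by rewrite mem_filter fpowersetE TS E Tn.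
Qed.
End Apex.

Definition mk_omorphism m n (f : 'I_m.+1 -> 'I_n.+1)
    (fH : {homo f : i j / (i <= j)%O}) : {omorphism 'I_m.+1 -> 'I_n.+1} :=
  HB.pack f (Order.isOrderMorphism.Build _ _ _ _ f fH).

(** Round down to A, and up below the least element of A. *)
Lemma exists_retraction n (A : {set 'I_n.+1}) i0 : i0 \in A ->
  exists r : {omorphism 'I_n.+1 -> 'I_n.+1},
    (forall i, r i \in A) /\ (forall i, i \in A -> r i = i).
Proof.
move=> Ai0.
case: (@arg_minnP _ i0 (mem A) (fun j : 'I_n.+1 => j : nat) Ai0) => s sA smin.
have As : s \in A := sA.
pose P i := fun j : 'I_n.+1 => (j \in A) && (j <= maxn i s)%N.
have Ps i : P i s by rewrite /P As leq_maxr.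
pose r i := [arg max_(j > s | P i j) (j : nat)].
have rP i : P i (r i) /\ forall j, P i j -> (j <= r i)%N.
  by rewrite /r; case: arg_maxnP => [|j Pj jmax]; [exact: Ps|split].
have rH : {homo r : i j / (i <= j)%O}.
  move=> i j ij; have {}ij : (i <= j)%N by [].
  change (r i <= r j)%N; apply: (rP j).2.
  have [/andP[Ar ri] _] := rP i; rewrite /P Ar (leq_trans ri) //.
  by rewrite geq_max leq_maxr andbT leq_max ij.
exists (mk_omorphism rH); split=> [i|i Ai].
  by have [/andP[]] := rP i.
have iE : maxn i s = i by apply/maxn_idPl; exact: smin.
apply: val_inj; apply/eqP; rewrite eqn_leq; have [/andP[_ ri] rmax] := rP i.
by rewrite iE in ri; apply/andP; split; [exact: ri|apply: rmax; rewrite /P Ai leq_maxl].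
Qed.

Section RealizationPoints.
Variables (R : realType) (Gam : graph).

Local Notation real := (realization R (Fl Gam)).

Definition point_of n (x : Fl Gam n) (t : set_type (@std_simplex R n)) : real :=
  (\pi_(real) (cell x t))%qT.

Lemma point_of_glue m n (f : {omorphism 'I_m.+1 -> 'I_n.+1}) (x : Fl Gam n)
    (s : set_type (@std_simplex R m)) (t : set_type (@std_simplex R n)) :
  (forall j, val t 0 j = \sum_(i | f i == j) val s 0 i) ->
  point_of (sop f x) s = point_of x t.
Proof. by move=> tE; apply/eqmodP/asboolP; exact: Glue. Qed.

Lemma std_simplex_ge0 n (t : set_type (@std_simplex R n)) i : 0 <= val t 0 i.
Proof. by have [+ _] := set_valP t; apply. Qed.

Lemma std_simplex_sum n (t : set_type (@std_simplex R n)) : \sum_i val t 0 i = 1.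
Proof. by have [_] := set_valP t. Qed.

Lemma std_simplex_support n (t : set_type (@std_simplex R n)) : exists i, val t 0 i != 0.
Proof.
apply: contrapT => /forallNP t0; have := std_simplex_sum t.
rewrite big1 => [/eqP|i _]; first by rewrite eq_sym oner_eq0.
by apply/eqP; have /negP := t0 i; rewrite negbK.
Qed.

(** Along a monotone retraction r onto the support of t both simplices pull back to
    the same simplex, and t is its own pushforward. *)
Lemma point_of_support n (x y : Fl Gam n) (t : set_type (@std_simplex R n)) :
  (forall i, val t 0 i != 0 -> val x i = val y i) -> point_of x t = point_of y t.
Proof.
move=> xy; pose A := [set i | val t 0 i != 0]%SET.
have [i0 ti0] := std_simplex_support t.
have Ai0 : i0 \in A by rewrite finset.in_set.
have [r [rA rid]] := exists_retraction Ai0.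
have push j : val t 0 j = \sum_(i | r i == j) val t 0 i.
  rewrite (bigID (mem A)) /= [X in _ + X]big1 ?addr0; last first.
    by move=> i /andP[_]; rewrite finset.in_set negbK => /eqP.
  have [Aj|nAj] := boolP (j \in A).
    rewrite (big_pred1 j) // => i /=; apply/andP/eqP => [[/eqP <- /rid//]|->].
    by rewrite rid.
  rewrite big_pred0 => [|i].
    by apply/eqP; move: nAj; rewrite finset.in_set negbK.
  by apply/negbTE; apply: contra nAj => /andP[/eqP <- _].
rewrite -(point_of_glue x push) -(point_of_glue y push).
congr (point_of _ _); apply: val_inj; apply: functional_extensionality_dep => i /=.
by apply: xy; have := rA i; rewrite finset.in_set.
Qed.

(** The weights a name a point after normalization.  Only the part of y in
    the support of a matters and has to be a clique; off the support the simplex x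
    replaces y by other vertices. *)
Definition represents n (y : 'I_n.+1 -> Gam) (a : 'I_n.+1 -> R) (p : real) :=
  exists (x : Fl Gam n) (t : set_type (@std_simplex R n)),
    [/\ forall i, a i != 0 -> val x i = y i,
        forall i, val t 0 i = a i / \sum_j a j & p = point_of x t].

Definition weights n (a : 'I_n.+1 -> R) := (forall i, 0 <= a i) /\ 0 < \sum_i a i.

Definition clique n (y : 'I_n.+1 -> Gam) (a : 'I_n.+1 -> R) :=
  forall i j, a i != 0 -> a j != 0 -> adj (y i) (y j).

Fact normalize_subproof n (a : 'I_n.+1 -> R) : weights a ->
  (\row_i (a i / \sum_j a j)) \in @std_simplex R n.
Proof.
move=> [a0 as0]; rewrite inE; split=> [i|].
  by rewrite mxE divr_ge0 // ltW.
by under eq_bigr do rewrite mxE; rewrite -mulr_suml divff // gt_eqF.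
Qed.

Definition normalize n (a : 'I_n.+1 -> R) (aw : weights a) : set_type (@std_simplex R n) :=
  exist (fun t => t \in @std_simplex R n) _ (normalize_subproof aw).

Lemma normalizeE n (a : 'I_n.+1 -> R) (aw : weights a) i :
  val (normalize aw) 0 i = a i / \sum_j a j.
Proof. by rewrite mxE. Qed.

Lemma weights_support n (a : 'I_n.+1 -> R) : weights a -> exists i, a i != 0.
Proof.
move=> [_ as0]; apply: contrapT => /forallNP a0; move: as0; rewrite big1 ?ltxx // => i _.
by apply/eqP; have /negP := a0 i; rewrite negbK.
Qed.

(** The simplex is y composed with a monotone retraction onto A. *)
Lemma clique_simplex n (y : 'I_n.+1 -> Gam) (A : {set 'I_n.+1}) i0 : i0 \in A ->
  (forall i j, i \in A -> j \in A -> adj (y i) (y j)) ->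
  exists x : Fl Gam n, forall i, i \in A -> val x i = y i.
Proof.
move=> Ai0 Ay; have [r [rA rid]] := exists_retraction Ai0.
have yr : (y \o r : 'I_n.+1 -> Gam) \in @flag Gam n by rewrite inE => i j _; exact: Ay.
by exists (exist (fun x => x \in @flag Gam n) _ yr) => i Ai /=; rewrite rid.
Qed.

Lemma represents_ex n (y : 'I_n.+1 -> Gam) (a : 'I_n.+1 -> R) :
  weights a -> clique y a -> exists p, represents y a p.
Proof.
move=> aw ac; have [i0 ai0] := weights_support aw.
have [||x xP] := @clique_simplex n y [set i | a i != 0]%SET i0.
- by rewrite finset.in_set.
- by move=> i j; rewrite !finset.in_set; exact: ac.
exists (point_of x (normalize aw)), x, (normalize aw); split=> // i.
  by move=> ai; apply: xP; rewrite finset.in_set.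
exact: normalizeE.
Qed.

(** The one tool for comparing names of points: it covers merging equal neighbours,
    dropping and inserting entries of weight zero, and permits different vertices
    off the support. *)
Lemma represents_push m n (g : {omorphism 'I_m.+1 -> 'I_n.+1})
    (y' : 'I_m.+1 -> Gam) (b : 'I_m.+1 -> R) (y : 'I_n.+1 -> Gam) (a : 'I_n.+1 -> R) p q :
  (forall i, 0 <= b i) -> (forall j, a j = \sum_(i | g i == j) b i) ->
  (forall i, b i != 0 -> y' i = y (g i)) ->
  represents y' b p -> represents y a q -> p = q.
Proof.
move=> b0 aE yg [x' [t' [x'y' t'E ->]]] [x [t [xy tE ->]]].
have sumE : \sum_j a j = \sum_i b i.
  under eq_bigr do rewrite aE.
  by rewrite [RHS](partition_big g predT).
rewrite -(@point_of_glue m n g x t' t).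
  apply: point_of_support => i t'i; have bi : b i != 0.
    by apply: contraNneq t'i => bi; rewrite t'E bi mul0r.
  rewrite x'y' // yg //= xy // aE gt_eqF //.
  rewrite (bigD1 i) //= ltr_wpDr ?sumr_ge0 // lt_def bi b0 //.
by move=> j; rewrite tE aE sumE mulr_suml; apply: eq_bigr => i _; rewrite t'E.
Qed.

Lemma represents_inj n (y : 'I_n.+1 -> Gam) (a : 'I_n.+1 -> R) p q :
  (forall i, 0 <= a i) -> represents y a p -> represents y a q -> p = q.
Proof.
move=> a0; apply: (represents_push (g := idfun)) => // j.
by rewrite (big_pred1 j).
Qed.
End RealizationPoints.

Lemma row_continuous (R : realType) (Z : topologicalType) n (f : 'I_n -> Z -> R) :
  (forall i, continuous (f i)) -> continuous (fun z => \row_i f i z : 'rV[R]_n).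
Proof.
move=> fc z U [P Pz PU].
have : \forall z' \near z, forall j, P ord0 j (f j z').
  apply: filter_forall => j; apply: fc; have := Pz ord0 j; by rewrite mxE.
by apply: filterS => z' Pz'; apply: PU => i j; rewrite mxE (ord1 i); exact: Pz'.
Qed.

Lemma set_type_continuous (T Z : topologicalType) (A : set T) (f : Z -> set_type A) :
  continuous (fun z => val (f z)) -> continuous f.
Proof.
move=> /continuousP fc; apply/continuousP => _ [B oB <-].
exact: (fc _ oB).
Qed.

Section Continuity.
Variables (R : realType) (Gam : graph).

Local Notation real := (realization R (Fl Gam)).

Lemma point_of_continuous n (x : Fl Gam n) : continuous (@point_of R Gam n x).
Proof.
move=> t; apply: (@continuous_comp _ _ _ (cell x) \pi_(real)%qT).
  exact: existT_continuous.
exact: pi_continuous.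
Qed.

Lemma sum_continuous (Z : topologicalType) (I : Type) (r : seq I) (P : pred I) (f : I -> Z -> R) :
  (forall i, P i -> continuous (f i)) -> continuous (fun z => \sum_(i <- r | P i) f i z).
Proof. by move=> fc; apply: continuous_big => //; exact: add_continuous. Qed.

(** Near a given point z0 only finitely many supports A occur, all containing
    that of z0; for each of them one simplex names the values at all z with
    support A as well as the value at z0.  Hence no subdivision of the domain
    has to be written down. *)
Lemma represents_continuous (Z : topologicalType) n (y : 'I_n.+1 -> Gam)
    (a : Z -> 'I_n.+1 -> R) (f : Z -> real) :
  (forall i, continuous (fun z => a z i)) -> (forall z, weights (a z)) ->
  (forall z, represents y (a z) (f z)) -> continuous f.
Proof.
move=> ac aw af z0 U Uz0.
pose supp z := [set i | a z i != 0]%SET.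
have supp_near : \forall z \near z0, supp z0 \subset supp z.
  have : \forall z \near z0, forall i, a z0 i != 0 -> a z i != 0.
    apply: filter_forall => i; have [ai|ai] := eqVneq (a z0 i) 0; first by apply: nearW.
    have nz : nbhs (a z0 i) (~` [set 0]).
      apply: open_nbhs_nbhs; split; last exact/eqP.
      by apply: closed_openC; exact: closed_eq.
    by apply: (@filterS _ (nbhs z0) _ _ _ _ (ac i z0 _ nz)) => z /= zi _; exact/eqP.
  apply: (@filterS _ (nbhs z0)) => z sz; apply/fintype.subsetP => i.
  by rewrite !finset.in_set; exact: sz.
have supp_each : \forall z \near z0, forall A : {set 'I_n.+1},
    supp z0 \subset A -> supp z = A -> U (f z).
  apply: filter_forall => A.
  have [[z1 [z1A sA]]|nA] := pselect (exists z1, supp z1 = A /\ supp z0 \subset A); last first.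
    by apply: nearW => z sA zA; case: nA; exists z.
  have [x [_ [xy _ _]]] := af z1.
  have rep z : supp z \subset A -> point_of x (normalize (aw z)) = f z.
    move=> zA; apply: (represents_inj (proj1 (aw z)) _ (af z)).
    exists x, (normalize (aw z)); split=> // [i ai|i]; last exact: normalizeE.
    apply: xy; have : i \in supp z1.
      by rewrite z1A; apply: (fintype.subsetP zA); rewrite finset.in_set.
    by rewrite finset.in_set.
  have gc : continuous (fun z => point_of x (normalize (aw z))).
    move=> z; apply: (@continuous_comp _ _ _ (fun z => normalize (aw z)) (point_of x)).
      apply: set_type_continuous; apply: row_continuous => i {}z.
      apply: (@continuousM _ _ (fun z => a z i) (fun z => (\sum_j a z j)^-1)).
        exact: ac.
      apply: continuousV; first by rewrite gt_eqF //; case: (aw z).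
      by apply: sum_continuous => j _; exact: ac.
    exact: point_of_continuous.
  have gU : nbhs (point_of x (normalize (aw z0))) U by rewrite rep.
  apply: (@filterS _ (nbhs z0) _ _ _ _ (gc z0 U gU)) => z /= Uz _ zA.
  by rewrite -rep // zA.
apply: (@filterS2 _ (nbhs z0) _ _ _ _ _ supp_near supp_each) => z sz each.
exact: (each (supp z)).
Qed.
End Continuity.

(** The tube lemma: a compact segment around s that f maps into an open set V at q
    is mapped into V at all points of an open set around q, and openness can be
    tested upstairs. *)
Lemma quotient_prod_continuous (R : realType) (T Z : topologicalType) (Q0 : quotType T)
    (f : quotient_topology Q0 * R -> Z) :
  continuous (fun p : T * R => f (\pi_(quotient_topology Q0)%qT p.1, p.2)) -> continuous f.
Proof.
move=> fc [q s] O; rewrite nbhsE => -[V [oV Vqs] VO].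
pose g p := f (\pi_(quotient_topology Q0)%qT p.1, p.2).
have [c qE] : exists c, q = \pi_(quotient_topology Q0)%qT c by exists (repr q); rewrite reprK.
have : nbhs (c, s) (g @^-1` V) by apply: fc; apply: open_nbhs_nbhs; rewrite /= -qE.
move=> [[A B] [/= cA sB] AB].
have [r r0 rB] : exists2 r, 0 < r & `[s - r, s + r]%classic `<=` B.
  move: sB => /nbhs_ballP[e /= e0 eB]; exists (e / 2); first by rewrite divr_gt0.
  move=> u; rewrite /= in_itv /= => /andP[su us]; apply: eB.
  by rewrite /ball /= ltr_norml; apply/andP; split; lra.
pose K := `[s - r, s + r]%classic.
pose W := [set q | forall u, K u -> V (f (q, u))].
have oW : open W.
  rewrite /open /= /quotient_open openE => d Wd.
  have cK : near_covering K by apply/compact_near_coveringP; exact: segment_compact.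
  apply: (cK _ (nbhs d) (fun c u => V (g (c, u)))) => u Ku.
  have /= [[A' B'] [dA' uB'] AB'] : nbhs (d, u) (g @^-1` V).
    by apply: fc; apply: open_nbhs_nbhs; split => //; exact: Wd.
  by exists (B', A') => //= -[u' d'] [/= Bu' Ad']; exact: (AB' (d', u')).
have Wq : W q.
  by move=> u Ku; rewrite qE; apply: (AB (c, u)); split; [exact: nbhs_singleton|exact: rB].
exists (W, K); last by move=> [q' u] [/= Wq' Ku]; apply: VO; exact: Wq'.
split; first by apply: open_nbhs_nbhs.
apply/nbhs_ballP; exists r => //= u; rewrite /ball /= ltr_norml => /andP[? ?].
by rewrite /K /= in_itv /=; apply/andP; split; lra.
Qed.

Lemma well_order_sort (T : choiceType) : exists2 leT : rel T, total leT &
  transitive leT /\ antisymmetric leT.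
Proof.
have [leT woT] := well_ordering_principle T.
have wo : wo_chain leT predT by move=> A _ /woT.
have tot : total leT by move=> x y; exact: (wo_chainW wo).
have anti : antisymmetric leT.
  by move=> x y xy; exact: (wo_chain_antisymmetric wo).
exists leT => //; split=> // y x z xy yz.
have [|m [[]]] := woT (mem [:: x; y; z]); first by exists x; rewrite inE eqxx.
rewrite !inE => /or3P[] /eqP -> mlb _.
- by apply: mlb; rewrite !inE eqxx !orbT.
- have yx : leT y x by apply: mlb; rewrite !inE eqxx.
  by rewrite (anti x y) ?xy.
- have zy : leT z y by apply: mlb; rewrite !inE eqxx orbT.
  by rewrite (anti z y) ?zy ?yz //.
Qed.

Section PositivePart.
Variable R : realType.

Definition pos (a : R) := Num.max 0 a.

Lemma pos_ge0 a : 0 <= pos a. Proof. by rewrite le_max lexx. Qed.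
Lemma pos_neq0 a : (pos a != 0) = (0 < a).
Proof. by rewrite /pos; case: (ltP 0 a) => [/gt_eqF ->//|_]; rewrite eqxx. Qed.
Lemma pos_gt0 a : (0 < pos a) = (0 < a).
Proof. by rewrite lt_def pos_ge0 andbT pos_neq0. Qed.
Lemma pos_eq0 a : a <= 0 -> pos a = 0.
Proof. by move=> a0; apply/eqP; rewrite -[_ == _]negbK pos_neq0 -leNgt. Qed.
Lemma pos_id a : 0 <= a -> pos a = a.
Proof. by move=> a0; apply/max_idPr. Qed.
End PositivePart.

Section VertexWeights.
Variables (R : realType) (Gam : graph).
Local Notation simplex n := (set_type (@std_simplex R n)).

(** A vertex may occur several times in a simplex.  The sum of its coordinates is
    unchanged by gluing, whereas the single coordinates are not. *)
Definition mass n (x : Fl Gam n) (t : simplex n) (z : Gam) : R :=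
  \sum_(i | val x i == z) val t 0 i.

Section Fixed.
Variables (n : nat) (x : Fl Gam n) (t : simplex n).
Local Notation w := (mass x t).

Lemma mass_ge0 z : 0 <= w z.
Proof. by apply: sumr_ge0 => i _; exact: std_simplex_ge0. Qed.

Lemma mass_gt0 i : val t 0 i != 0 -> 0 < w (val x i).
Proof.
move=> ti; rewrite /mass (bigD1 i) //= ltr_wpDr ?sumr_ge0 // => [j _|].
  exact: std_simplex_ge0.
by rewrite lt_def ti std_simplex_ge0.
Qed.

Lemma mass_out z : z \notin codom (val x) -> w z = 0.
Proof.
move=> nz; rewrite /mass big_pred0 // => i; apply/negbTE.
by apply: contra nz => /eqP <-; exact: codom_f.
Qed.

Lemma sum_mass (l : seq Gam) : uniq l ->
  \sum_(z <- l) w z = \sum_(i | val x i \in l) val t 0 i.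
Proof.
elim: l => [_|z l IH /= /andP[zl ul]]; first by rewrite big_nil big_pred0.
rewrite big_cons IH // [RHS](bigID (fun i => val x i == z)) /=; congr (_ + _).
  by apply: eq_bigl => i; rewrite inE /=; case: (sval x i =P z) => //= _; rewrite andbF.
apply: eq_bigl => i; rewrite inE; have [->|] //= := eqVneq (val x i) z.
  by rewrite (negbTE zl).
by rewrite andbT.
Qed.

Lemma sum_mass_le1 (l : seq Gam) : uniq l -> \sum_(z <- l) w z <= 1.
Proof.
move=> ul; rewrite sum_mass // -(std_simplex_sum t) [leRHS](bigID (fun i => val x i \in l)) /=.
by rewrite lerDl sumr_ge0 // => i _; exact: std_simplex_ge0.
Qed.

Lemma mass_le1 z : w z <= 1.
Proof. by have := @sum_mass_le1 [:: z] isT; rewrite big_seq1. Qed.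
End Fixed.

Lemma mass_sop m n (f : {omorphism 'I_m.+1 -> 'I_n.+1}) (x : Fl Gam n)
    (u : simplex m) (t : simplex n) :
  (forall j, val t 0 j = \sum_(i | f i == j) val u 0 i) ->
  mass (sop f x) u = mass x t.
Proof.
move=> tE; apply: functional_extensionality_dep => z.
rewrite /mass [LHS](partition_big f (fun j => val x j == z)) //=.
apply: eq_bigr => j /eqP xj; rewrite tE; apply: eq_bigl => i.
apply: andb_idl => /eqP fij; rewrite /= fij; apply/eqP; exact: xj.
Qed.

Variable w : Gam -> R.

(** For a total mass 1 this is the mass outside S, written without mention of the
    vertices there. *)
Definition deficit (S : {fset Gam}) : R := 1 - \sum_(z <- S) w z.

(** At time s a vertex is still present as long as its mass exceeds the level
    3 s - 1, and the apex of S is present once that level has passed the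
    deficit of S, provided that the mass of every member of S exceeds it.  The
    sets satisfying the latter condition form a chain.  The factors 1 - s remove
    the apexes of nonempty sets at time 1. *)
Definition vertex_factor (s : R) (z : Gam) : R := pos (Num.min 1 (w z + 1 - 3 * s)).
Definition apex_weight (s : R) (S : {fset Gam}) : R :=
  pos (3 * s - 1 - deficit S) * \prod_(z <- S) (pos (1 - s) * pos (w z - deficit S)).

Lemma vertex_factor_ge0 s z : 0 <= vertex_factor s z.
Proof. exact: pos_ge0. Qed.

Lemma apex_weight_ge0 s S : 0 <= apex_weight s S.
Proof. by rewrite mulr_ge0 ?pos_ge0 // prodr_ge0 // => z _; rewrite mulr_ge0 ?pos_ge0. Qed.

Lemma vertex_factor_neq0 s z : vertex_factor s z != 0 -> 3 * s - 1 < w z.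
Proof. by rewrite pos_neq0 lt_min => /andP[_]; lra. Qed.

Lemma apex_weight_neq0 s S : apex_weight s S != 0 ->
  deficit S < 3 * s - 1 /\ forall z, z \in S -> deficit S < w z.
Proof.
rewrite mulf_eq0 negb_or pos_neq0 subr_gt0 => /andP[-> ]; rewrite prodf_seq_neq0 => /allP Sw.
split=> // z zS; have := Sw z zS.
by rewrite /= mulf_eq0 negb_or !pos_neq0 => /andP[_]; rewrite subr_gt0.
Qed.
End VertexWeights.

Section Homotopy.
Variables (R : realType) (Gam : graph) (v : {fset Gam} -> Gam).
Hypothesis v_member : forall (S : {fset Gam}) x, x \in S -> adj x (v S).
Hypothesis v_subset : forall S T : {fset Gam}, (T `<=` S)%fset -> adj (v T) (v S).
Variable leT : rel {fset Gam}.
Hypotheses (leT_total : total leT) (leT_trans : transitive leT)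
  (leT_anti : antisymmetric leT).

Local Notation real := (realization R (Fl Gam)).
Local Notation simplex n := (set_type (@std_simplex R n)).

(** The sets of vertices of x, in an order that does not depend on x, so that the
    lists for x and for a simplex operated on by a monotone map match. *)
Definition faces n (x : Fl Gam n) : seq {fset Gam} :=
  sort leT (enum_fset (fpowerset [fset z in codom (val x)]%fset)).

Lemma mem_faces n (x : Fl Gam n) (S : {fset Gam}) :
  (S \in faces x) = (S `<=` [fset z in codom (val x)])%fset.
Proof. by rewrite mem_sort fpowersetE. Qed.

Lemma mem_facesP n (x : Fl Gam n) (S : {fset Gam}) :
  reflect (forall z, z \in S -> z \in codom (val x)) (S \in faces x).
Proof.
rewrite mem_faces; apply: (iffP idP) => [/fsubsetP Sx z zS|Sx].
  by have := Sx z zS; rewrite in_fset.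
by apply/fsubsetP => z zS; rewrite in_fset; exact: Sx.
Qed.

Lemma faces_uniq n (x : Fl Gam n) : uniq (faces x).
Proof. by rewrite sort_uniq fset_uniq. Qed.

Lemma deficit_ge0 n (x : Fl Gam n) (t : simplex n) S : 0 <= deficit (mass x t) S.
Proof. by rewrite subr_ge0 sum_mass_le1. Qed.

(** This inequality makes the sets with positive apex weight a chain and forces the
    vertices still present to belong to all of them. *)
Lemma mass_le_deficit n (x : Fl Gam n) (t : simplex n) (S : {fset Gam}) z :
  z \notin S -> mass x t z <= deficit (mass x t) S.
Proof.
move=> zS; have := @sum_mass_le1 R Gam n x t (z :: S).
by rewrite /= zS fset_uniq => /(_ isT); rewrite big_cons /deficit; lra.
Qed.

Section Lists.
Variables (n : nat) (x : Fl Gam n).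
Local Notation l := (faces x).

Definition track_vertices (i : 'I_(n.+1 + size l)) : Gam :=
  match fintype.split i with inl j => val x j | inr k => v (nth fset0 l k) end.

Definition track_weights (t : simplex n) (s : R) (i : 'I_(n.+1 + size l)) : R :=
  match fintype.split i with
  | inl j => val t 0 j * vertex_factor (mass x t) s (val x j)
  | inr k => apex_weight (mass x t) s (nth fset0 l k)
  end.

Lemma track_verticesl j : track_vertices (lshift _ j) = val x j.
Proof. by rewrite /track_vertices (unsplitK (inl j)). Qed.
Lemma track_verticesr k : track_vertices (rshift _ k) = v (nth fset0 l k).
Proof. by rewrite /track_vertices (unsplitK (inr k)). Qed.
Lemma track_weightsl t s j :
  track_weights t s (lshift _ j) = val t 0 j * vertex_factor (mass x t) s (val x j).
Proof. by rewrite /track_weights (unsplitK (inl j)). Qed.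
Lemma track_weightsr t s k :
  track_weights t s (rshift _ k) = apex_weight (mass x t) s (nth fset0 l k).
Proof. by rewrite /track_weights (unsplitK (inr k)). Qed.

Lemma track_weights_ge0 t s i : 0 <= track_weights t s i.
Proof.
rewrite /track_weights; case: (fintype.split i) => j; last exact: apex_weight_ge0.
by rewrite mulr_ge0 ?std_simplex_ge0 ?vertex_factor_ge0.
Qed.

(** At time 1 and later the apex of the empty set is present.  Before, if no vertex
    of the simplex is present any more, then the level has passed all masses, and the
    apex of the full support is present. *)
Lemma track_weights_gt0 t s : exists i, 0 < track_weights t s i.
Proof.
have face_gt0 S : S \in l -> 0 < apex_weight (mass x t) s S -> exists i, 0 < track_weights t s i.
  move=> Sl S0; have il : (index S l < size l)%N by rewrite index_mem.
  by exists (rshift _ (Ordinal il)); rewrite track_weightsr nth_index.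
have [s1|s1] := leP 1 s.
  apply: (face_gt0 fset0); first by apply/mem_facesP => z; rewrite in_fset0.
  by rewrite /apex_weight /deficit !big_seq_fset0 mulr1 pos_gt0; lra.
have [[j j0]|/forallNP nj] :=
    pselect (exists j, 0 < val t 0 j * vertex_factor (mass x t) s (val x j)).
  by exists (lshift _ j); rewrite track_weightsl.
pose S : {fset Gam} := [fset z in codom (val x) | 0 < mass x t z]%fset.
have def0 : deficit (mass x t) S = 0.
  rewrite /deficit sum_mass ?fset_uniq // -(std_simplex_sum t).
  rewrite [X in X - _](bigID (fun i => val x i \in S)) /= addrAC subrr add0r big1 // => i iS.
  apply/eqP; apply: contraNT iS => /(mass_gt0 x) ti.
  by rewrite !inE /= codom_f ti.
have low j : val t 0 j != 0 -> mass x t (val x j) <= 3 * s - 1.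
  move=> tj; have := nj j; rewrite pmulr_rgt0 ?lt_def ?tj ?std_simplex_ge0 //.
  rewrite vertex_factor_ge0 andbT /vertex_factor pos_neq0 lt_min ltr01 /= => /negP.
  by rewrite -leNgt; lra.
have [j tj] := std_simplex_support t.
apply: (face_gt0 S); first by apply/mem_facesP => z; rewrite !inE => /andP[].
rewrite /apex_weight def0 mulr_gt0 //.
  by rewrite pos_gt0; have := low j tj; have := mass_gt0 x tj; lra.
rewrite big_seq prodr_gt0 // => z; rewrite !inE => /andP[_ z0].
by rewrite mulr_gt0 // pos_gt0; lra.
Qed.

Lemma track_is_weights t s : weights (track_weights t s : 'I_(n + size l).+1 -> R).
Proof.
split=> [i|]; first exact: track_weights_ge0.
have [i i0] := track_weights_gt0 t s.
rewrite (bigD1 (i : 'I_(n + size l).+1)) //= ltr_wpDr // sumr_ge0 // => j _.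
exact: track_weights_ge0.
Qed.

(** Two apexes with positive weight belong to nested sets, and a vertex with positive
    weight belongs to all of these. *)
Lemma track_clique t s :
  clique (track_vertices : 'I_(n + size l).+1 -> Gam) (track_weights t s).
Proof.
have vertex_apex j S : val t 0 j * vertex_factor (mass x t) s (val x j) != 0 ->
    apex_weight (mass x t) s S != 0 -> adj (val x j) (v S).
  rewrite mulf_eq0 negb_or => /andP[_ /vertex_factor_neq0 wj] /apex_weight_neq0[Sd _].
  apply: v_member; apply: contraT => /(mass_le_deficit x t) wd.
  by move: wj Sd wd; lra.
have apex_apex S T : apex_weight (mass x t) s S != 0 ->
    apex_weight (mass x t) s T != 0 -> adj (v S) (v T).
  move=> /apex_weight_neq0[_ Sd] /apex_weight_neq0[_ Td].
  have [ST|/fsubsetPn[z zS zT]] := boolP (S `<=` T)%fset; first exact: v_subset.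
  have [TS|/fsubsetPn[z' z'T z'S]] := boolP (T `<=` S)%fset.
    by apply: adj_sym; exact: v_subset.
  have := Sd z zS; have := Td z' z'T.
  by have := mass_le_deficit x t zT; have := mass_le_deficit x t z'S; lra.
move=> i j; rewrite /track_weights /track_vertices.
case: (@fintype.split n.+1 _ i) => i'; case: (@fintype.split n.+1 _ j) => j'.
- move=> _ _; have [ij|ji|/val_inj ->] := ltngtP i' j'; last by left.
    exact: (set_valP x).
  by apply: adj_sym; exact: (set_valP x).
- exact: vertex_apex.
- by move=> Si jj; apply: adj_sym; exact: vertex_apex.
- exact: apex_apex.
Qed.
End Lists.

Definition track n (x : Fl Gam n) (t : simplex n) (s : R) : set real :=
  represents (@track_vertices n x : 'I_(n + size (faces x)).+1 -> Gam) (@track_weights n x t s).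

Lemma track_ex n (x : Fl Gam n) t s : exists p, track x t s p.
Proof. exact: represents_ex (track_is_weights x t s) (@track_clique n x t s). Qed.

Lemma lshift_homo m k : {homo @lshift m.+1 k : i j / (i <= j)%O >-> (i <= j)%O}.
Proof. by []. Qed.

Lemma track0 n (x : Fl Gam n) t p : track x t 0 p -> p = point_of x t.
Proof.
pose g := @mk_omorphism n (n + size (faces x)) _ (@lshift_homo n (size (faces x))).
move=> xp; apply/esym; apply: (represents_push (g := g) (y' := val x) (b := fun i => val t 0 i)) xp.
- exact: std_simplex_ge0.
- move=> j; case: (splitP (j : 'I_(n.+1 + size (faces x)))) => [j' jE|k jE].
    have {jE}-> : j = lshift (size (faces x)) j' by apply: val_inj.
    rewrite track_weightsl (big_pred1 j') => [|i]; last first.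
      by apply/eqP/eqP => [/(@lshift_inj n.+1)|->].
    rewrite /vertex_factor mulr0 subr0 (min_idPl _) ?pos_id ?mulr1 //.
    by rewrite lerDr mass_ge0.
  have {jE}-> : j = rshift n.+1 k by apply: val_inj.
  rewrite track_weightsr big_pred0 => [|i]; last exact: (@eq_lrshift n.+1).
  rewrite /apex_weight pos_eq0 ?mul0r // mulr0.
  by have := deficit_ge0 x t (nth fset0 (faces x) k); lra.
- by move=> i _; rewrite track_verticesl.
- exists x, t; split=> // i; by rewrite std_simplex_sum divr1.
Qed.

Definition end_vertex : Fl Gam 0 := vertex_simplex (v fset0).
Definition end_weights : 'I_1 -> R := fun=> 1.

Lemma end_weightsP : weights end_weights.
Proof. by split=> [i|]; rewrite ?big_ord1 ?ler01 ?ltr01. Qed.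

Definition end_point : real := point_of end_vertex (normalize end_weightsP).

Lemma track1 n (x : Fl Gam n) t p : track x t 1 p -> p = end_point.
Proof.
have f0 : fset0 \in faces x by apply/mem_facesP => z; rewrite in_fset0.
have il : (index fset0 (faces x) < size (faces x))%N by rewrite index_mem.
pose k0 := rshift n.+1 (Ordinal il).
have gH : {homo (fun=> k0 : 'I_(n + size (faces x)).+1) : i j / (i <= j :> 'I_1)%O >-> (i <= j)%O}.
  by move=> i j _; exact: lexx.
pose g := @mk_omorphism 0 (n + size (faces x)) _ gH.
move=> xp; apply/esym.
apply: (represents_push (g := g) (y' := fun=> v fset0) (b := end_weights)) xp.
- exact: (proj1 end_weightsP).
- move=> j; rewrite big_mkcond big_ord1 /=.
  case: (splitP (j : 'I_(n.+1 + size (faces x)))) => [j' jE|k jE].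
    have {jE}-> : j = lshift (size (faces x)) j' by apply: val_inj.
    rewrite track_weightsl ifF; last exact: (@eq_rlshift n.+1).
    rewrite /vertex_factor pos_eq0 ?mulr0 //.
    by rewrite ge_min; apply/orP; right; have := mass_le1 x t (val x j'); lra.
  have {jE}-> : j = rshift n.+1 k by apply: val_inj.
  rewrite track_weightsr; case: eqP => [/(@rshift_inj n.+1) <-|kn] /=.
    by rewrite nth_index // /end_weights /apex_weight /deficit !big_seq_fset0 pos_id; lra.
  have : nth fset0 (faces x) k != fset0.
    apply/eqP => k0E; apply: kn; apply: val_inj.
    by rewrite /= -k0E index_uniq // faces_uniq.
  case/fset0Pn => z zS; rewrite /apex_weight (big_fsetD1 z) //=.
  by rewrite subrr [pos 0]pos_eq0 // !(mul0r, mulr0).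
- by move=> i _; rewrite track_verticesr nth_index.
- exists end_vertex, (normalize end_weightsP); split=> // i.
  exact: normalizeE.
Qed.

Lemma leT_refl : reflexive leT.
Proof. by move=> S; have := leT_total S S; rewrite orbb. Qed.

Lemma faces_sorted n (x : Fl Gam n) : sorted leT (faces x).
Proof. exact: sort_sorted. Qed.

(** Masses, hence all weights, are invariant under gluing.  The monotone map f is
    extended to the apexes by the inclusion of the list of faces. *)
Lemma track_glue m n (f : {omorphism 'I_m.+1 -> 'I_n.+1}) (x : Fl Gam n)
    (u : simplex m) (t : simplex n) s p q :
  (forall j, val t 0 j = \sum_(i | f i == j) val u 0 i) ->
  track (sop f x) u s p -> track x t s q -> p = q.
Proof.
move=> tE; set x' := sop f x; set l' := faces x'; set l := faces x.
have l'l S : S \in l' -> S \in l.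
  move=> /mem_facesP Sl'; apply/mem_facesP => z /Sl' /codomP[i ->].
  exact: codom_f.
have index_lt S : S \in l' -> (index S l < size l)%N by move=> /l'l; rewrite index_mem.
pose gr (k : 'I_(size l')) : 'I_(size l) := Ordinal (index_lt _ (mem_nth fset0 (ltn_ord k))).
pose gf (i : 'I_(m + size l').+1) : 'I_(n + size l).+1 :=
  match @fintype.split m.+1 (size l') i with
  | inl j => lshift (size l) (f j) | inr k => rshift n.+1 (gr k) end.
have gfl j : gf (@lshift m.+1 (size l') j) = lshift (size l) (f j).
  by rewrite /gf (unsplitK (inl j)).
have gfr k : gf (@rshift m.+1 (size l') k) = rshift n.+1 (gr k).
  by rewrite /gf (unsplitK (inr k)).
have ordsplit a b (i : 'I_(a.+1 + b)) : (exists j, i = lshift b j) \/ (exists k, i = rshift a.+1 k).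
  by case: (splitP i) => [j|k] iE; [left; exists j|right; exists k]; exact: val_inj.
have gH : {homo gf : i j / (i <= j)%O >-> (i <= j)%O}.
  move=> i j; case: (ordsplit _ _ i) => -[i' ->]; case: (ordsplit _ _ j) => -[j' ->].
  - by rewrite !gfl => ij; apply: (omorph_le f).
  - by rewrite gfl gfr => _; rewrite leEord /= (leq_trans (ltnW (ltn_ord _))) // leq_addr.
  - rewrite leEord /= => /(leq_trans (leq_addr _ _)).
    by rewrite leqNgt ltn_ord.
  - rewrite !gfr !leEord /= !leq_add2l => ij.
    set S := nth fset0 l' i'; set T := nth fset0 l' j'.
    have Sl' : S \in l' by exact: mem_nth.
    have Tl' : T \in l' by exact: mem_nth.
    have ST : leT S T.
      apply: (sorted_leq_index leT_trans leT_refl (faces_sorted x')) => //.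
      by rewrite /S /T !index_uniq ?faces_uniq.
    rewrite leqNgt; apply/negP; rewrite -/S -/T => TS.
    have TS' : leT T S.
      apply: (sorted_leq_index leT_trans leT_refl (faces_sorted x)); try exact: l'l.
      exact: ltnW.
    by move: TS; rewrite (leT_anti (introT andP (conj ST TS'))) ltnn.
pose g := @mk_omorphism (m + size l') (n + size l) _ gH.
have wE := mass_sop x tE.
apply: (represents_push (g := g)).
- by move=> i; exact: track_weights_ge0.
- move=> j; rewrite big_mkcond (@big_split_ord _ _ _ m.+1 (size l')) /=.
  under eq_bigr do rewrite gfl track_weightsl wE.
  under [X in _ + X]eq_bigr do rewrite gfr track_weightsr wE.
  case: (ordsplit _ _ j) => -[j' ->].
    rewrite [X in _ + X]big1 ?addr0 => [|k _]; last by rewrite ifF //; exact: (@eq_rlshift n.+1).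
    rewrite track_weightsl tE mulr_suml [LHS]big_mkcond; apply: eq_bigr => i _.
    case: (f i =P j') => [<-|ij]; first by rewrite ifT.
    by rewrite ifF //; apply/eqP => /(@lshift_inj n.+1).
  rewrite [X in X + _]big1 ?add0r => [|i _]; last by rewrite ifF //; exact: (@eq_lrshift n.+1).
  rewrite track_weightsr; set S := nth fset0 l j'.
  have Sl : S \in l by exact: mem_nth.
  transitivity (\sum_(T <- l' | T == S) apex_weight (mass x t) s T); last first.
    rewrite big_mkcond (big_nth fset0) big_mkord; apply: eq_bigr => k _.
    have kl : nth fset0 l' k \in l by apply: l'l; exact: mem_nth.
    case: (nth fset0 l' k =P S) => [kS|kS].
      by rewrite ifT //; apply/eqP/val_inj; rewrite /= kS index_uniq // faces_uniq.
    rewrite ifF //; apply/eqP => /(@rshift_inj n.+1)/(congr1 val) /= kj.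
    by apply: kS; rewrite /S -kj nth_index.
  have [Sl'|nSl'] := boolP (S \in l').
    by rewrite -big_filter (perm_big [:: S]) ?big_seq1 // filter_pred1_uniq // faces_uniq.
  rewrite big_seq_cond big_pred0 => [|T]; last first.
    by apply: contraNF nSl' => /andP[Tl' /eqP <-].
  have [z zS zx] : exists2 z, z \in S & z \notin codom (val x').
    apply: contrapT => nz; case/negP: nSl'; apply/mem_facesP => z zS.
    by apply: contrapT => /negP zx; case: nz; exists z.
  rewrite /apex_weight (big_fsetD1 z) //= -wE (mass_out u zx) sub0r.
  by rewrite [pos (- _)]pos_eq0 ?oppr_le0 ?deficit_ge0 // !(mul0r, mulr0).
- move=> i _; case: (ordsplit _ _ i) => -[i' ->] /=.
    by rewrite gfl !track_verticesl.
  by rewrite gfr !track_verticesr /= nth_index //; apply: l'l; exact: mem_nth.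
Qed.
End Homotopy.

Section ContinuousFunctions.
Variables (R : realType) (Z : topologicalType).
Implicit Types f g : Z -> R.

Lemma cont_add f g : continuous f -> continuous g -> continuous (fun z => f z + g z).
Proof. by move=> fc gc z; apply: continuousD; [exact: fc|exact: gc]. Qed.
Lemma cont_sub f g : continuous f -> continuous g -> continuous (fun z => f z - g z).
Proof. by move=> fc gc z; apply: continuousB; [exact: fc|exact: gc]. Qed.
Lemma cont_mul f g : continuous f -> continuous g -> continuous (fun z => f z * g z).
Proof. by move=> fc gc z; apply: continuousM; [exact: fc|exact: gc]. Qed.
Lemma cont_cst (a : R) : continuous (fun _ : Z => a).
Proof. by move=> z; exact: cvg_cst. Qed.
Lemma cont_pos f : continuous f -> continuous (fun z => pos (f z)).
Proof. by move=> fc z; apply: (@continuous_max _ _ (fun=> 0) f); [exact: cvg_cst|exact: fc]. Qed.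
Lemma cont_min f g : continuous f -> continuous g -> continuous (fun z => Num.min (f z) (g z)).
Proof. by move=> fc gc z; apply: (@continuous_min _ _ f g); [exact: fc|exact: gc]. Qed.
Lemma cont_prod (I : Type) (r : seq I) (f : I -> Z -> R) :
  (forall i, continuous (f i)) -> continuous (fun z => \prod_(i <- r) f i z).
Proof. by move=> fc; apply: continuous_big => //; exact: mul_continuous. Qed.
End ContinuousFunctions.

Section TrackContinuity.
Variables (R : realType) (Gam : graph) (v : {fset Gam} -> Gam).
Hypothesis v_member : forall (S : {fset Gam}) x, x \in S -> adj x (v S).
Hypothesis v_subset : forall S T : {fset Gam}, (T `<=` S)%fset -> adj (v T) (v S).
Variable leT : rel {fset Gam}.
Hypotheses (leT_total : total leT) (leT_trans : transitive leT)
  (leT_anti : antisymmetric leT).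

Local Notation real := (realization R (Fl Gam)).
Local Notation simplex n := (set_type (@std_simplex R n)).

Lemma coordinate_continuous n j :
  continuous (fun z : simplex n * R => val z.1 0 j).
Proof.
move=> z; apply: (@continuous_comp _ _ _ (fun z : simplex n * R => val z.1)
  (fun t : 'rV[R]_n.+1 => t 0 j)); last first.
  exact: coord_continuous.
apply: (@continuous_comp _ _ _ fst (fun t : simplex n => val t)); first exact: cvg_fst.
exact: (@initial_continuous _ _ (@set_val _ (@std_simplex R n))).
Qed.

Lemma mass_continuous n (x : Fl Gam n) c :
  continuous (fun z : simplex n * R => mass x z.1 c).
Proof. by apply: sum_continuous => i _; exact: coordinate_continuous. Qed.

Lemma time_continuous n : continuous (fun z : simplex n * R => z.2).
Proof. by move=> z; exact: cvg_snd. Qed.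

Lemma track_weights_continuous n (x : Fl Gam n) i :
  continuous (fun z : simplex n * R => @track_weights R Gam leT n x z.1 z.2 i).
Proof.
rewrite /track_weights; case: (fintype.split i) => j.
  apply: cont_mul; first exact: coordinate_continuous.
  apply: cont_pos; apply: cont_min; first exact: cont_cst.
  apply: cont_sub.
    by apply: cont_add; [exact: mass_continuous|exact: cont_cst].
  by apply: cont_mul; [exact: cont_cst|exact: time_continuous].
have defc S : continuous (fun z : simplex n * R => deficit (mass x z.1) S).
  apply: cont_sub; first exact: cont_cst.
  by apply: sum_continuous => c _; exact: mass_continuous.
apply: cont_mul.
  apply: cont_pos; apply: cont_sub; last exact: defc.
  apply: cont_sub; last exact: cont_cst.
  by apply: cont_mul; [exact: cont_cst|exact: time_continuous].
apply: cont_prod => c; apply: cont_mul; apply: cont_pos; apply: cont_sub.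
- exact: cont_cst.
- exact: time_continuous.
- exact: mass_continuous.
- exact: defc.
Qed.

Lemma track_continuous n (x : Fl Gam n) (f : simplex n * R -> real) :
  (forall z, track v leT x z.1 z.2 (f z)) -> continuous f.
Proof.
move=> fP; apply: (@represents_continuous R Gam _ (n + size (faces leT x))
  (@track_vertices Gam v leT n x) (fun z => @track_weights R Gam leT n x z.1 z.2)) fP => [i|z].
  exact: track_weights_continuous.
exact: track_is_weights.
Qed.

Lemma track_contractible : contractible R real.
Proof.
pose cellp (c : cells R (Fl Gam)) s p := track v leT (tagged (tag c)) (tagged c) s p.
have /choice[h hP] : forall cs : cells R (Fl Gam) * R, exists p, cellp cs.1 cs.2 p.
  by move=> cs; exact: track_ex.
have h_glue c d s : Defs.glue c d -> h (c, s) = h (d, s).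
  elim=> [m n f x u t tE|//|a b _ -> //|a b e _ -> _ -> //].
  have h1 : track v leT (sop f x) u s (h (cell (sop f x) u, s)) := hP (cell (sop f x) u, s).
  have h2 : track v leT x t s (h (cell x t, s)) := hP (cell x t, s).
  exact: (track_glue leT_total leT_trans leT_anti tE h1 h2).
pose H (p : real * R) := h (repr p.1, p.2).
have HE c s : H (\pi_(real)%qT c, s) = h (c, s).
  apply: h_glue; have : glue_rel R (Fl Gam) (repr (\pi_(real)%qT c)) c.
    by apply/eqmodP; exact: reprK.
  by move=> /asboolP.
have Hc : continuous H.
  apply: quotient_prod_continuous.
  have -> : (fun p : cells R (Fl Gam) * R => H (\pi_(real)%qT p.1, p.2)) = h.
    by apply: functional_extensionality_dep => -[c s]; exact: HE.
  move=> [[[n x] t] s] O hO.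
  have fc : continuous (fun z : simplex n * R => h (cell x z.1, z.2)).
    by apply: (track_continuous (x := x)) => z; exact: (hP (cell x z.1, z.2)).
  have [[A B] [/= tA sB] AB] := fc (t, s) O hO.
  exists (existT _ (existT _ n x) @` A, B).
    by split => //=; exact: existT_nbhs.
  by move=> [_ s'] [/= [t' At' <-] Bs']; exact: (AB (t', s')).
exists (end_point R v), H; split.
- exact: continuous_subspaceT.
- move=> q; rewrite -[q in LHS]reprK HE.
  have := track0 (hP (repr q, 0)); rewrite /= => ->.
  rewrite /point_of -[RHS]reprK; congr (\pi_(real)%qT _).
  by case: (repr q) => -[n x] t.
- by move=> q; exact: track1 (hP (repr q, 1)).
Qed.
End TrackContinuity.

Lemma common_neighbour_contractible (R : realType) (Gam : graph) :
  (forall l : seq Gam, exists z, forall x, x \in l -> adj x z) ->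
  contractible R (realization R (Fl Gam)).
Proof.
move=> GamP; have [v [v_member v_subset]] := exists_apex GamP.
have [leT leT_total [leT_trans leT_anti]] := well_order_sort {fset Gam}.
exact: (@track_contractible R Gam v v_member v_subset leT leT_total leT_trans leT_anti).
Qed.
Theorem proposition3p6 (R : realType) (D : unitRingType)
  (D_division : forall a : D, a != 0 -> a \is a GRing.unit)
  (J : involution D) (eps : D) (eps_sign : eps = 1 \/ eps = -1)
  (Deps_infinite : infinite_set [set a : D | a - J a * eps = 0])
  (M : vectType D^c) (h : hermitian_form J (- eps) M)
  (M_hyperbolic : hyperbolic h) :
  let Gamma := opposition_ggraph h in
  let pt := point_ggraph (unitary_group h) in
  [/\ acyclic (Fl Gamma),
      contractible R (realization R (Fl Gamma)) &
      forall P : projective_resolution (unitary_group h),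
        (forall n : nat,
           bijective (eqv_homology_map P (Fl_const Gamma) n) /\
           bijective (eqv_homology_aug P (gFl pt) n)) /\
        (forall (A : zmodType) (n : nat),
           bijective (eqv_cohomology_map P A (Fl_const Gamma) n) /\
           bijective (eqv_cohomology_aug P A (gFl pt) n))].
Proof.
move=> Gamma pt.
have GammaP : forall l : seq Gamma, exists Z, forall X, X \in l -> adj X Z.
  exact: (opposition_common_neighbour D_division eps_sign Deps_infinite M_hyperbolic).
have Gamma_exact : aug_exact (gFl Gamma) := Fl_aug_exact GammaP.
have pt_exact : aug_exact (gFl pt) := point_aug_exact.
split; first exact: common_neighbour_acyclic.
  exact: common_neighbour_contractible.
move=> P; split=> [n|A n]; split.
- exact: eqv_homology_map_bij.
- exact: eqv_homology_aug_bij.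
- exact: eqv_cohomology_map_bij.
- exact: eqv_cohomology_aug_bij.
Qed.
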